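(* Let $n\ge2$. If $G\colon\mathrm{LC}_{\mathrm c}(\mathbb{R}^n)\to[0,\infty]$ is a lower semicontinuous, log-convex functional on $\mathrm{LC}_{\mathrm c}(\mathbb{R}^n)$ that is invariant under rotations, then $$G(f_{\mathrm{rot}})\le G(f)$$ for every $f\in\mathrm{LC}_{\mathrm c}(\mathbb{R}^n)$. For $n=1$, the same inequality holds if $G$ is assumed to be log-convex on $\mathrm{LC}_{\mathrm c}(\mathbb{R})$ and invariant under reflections.
   Context: $\mathrm{Conv}_{\mathrm c}(\mathbb{R}^n)$ is the set of convex functions $\psi\colon\mathbb{R}^n\to(-\infty,\infty]$ that are proper ($\psi\not\equiv\infty$), lower semicontinuous, and coercive ($\lim_{|x|\to\infty}\psi(x)=\infty$). $\mathrm{LC}_{\mathrm c}(\mathbb{R}^n)=\{f=e^{-\psi}:\psi\in\mathrm{Conv}_{\mathrm c}(\mathbb{R}^n)\}$ (with $e^{-\infty}=0$). Asplund sum: $(f\star g)(x)=\sup_{y\in\mathbb{R}^n}f(y)g(x-y)$. Homothety: $(\lambda\cdot f)(x)=f(x/\lambda)^\lambda$ for $\lambda>0$. Convention: a functional $G$ ''with values in $[0,\infty]$'' never attains both values $0$ and $\infty$. $G$ is log-convex if $G(\lambda\cdot f\star(1-\lambda)\cdot g)\le G(f)^\lambda G(g)^{1-\lambda}$ for all $f,g\in\mathrm{LC}_{\mathrm c}(\mathbb{R}^n)$ and $\lambda\in(0,1)$. $G$ is invariant under rotations if $G(f\circ\vartheta)=G(f)$ for every $f$ and every $\vartheta\in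 \mathrm{SO}(n)$; for $n=1$, invariant under reflections means this holds for every $\vartheta\in \mathrm{O}(1)=\{\pm1\}$. Semicontinuity is with respect to hypo-convergence: $f_j$ hypo-converges to $f$ if for every $x\in\mathbb{R}^n$, $f(x)\ge\limsup_jf_j(x_j)$ for every $x_j\to x$, and $f(x)=\lim_jf_j(x_j)$ for some $x_j\to x$. Legendre--Fenchel transform: $\mathcal{L}\psi(x)=\sup_{y\in\mathbb{R}^n}(\langle x,y\rangle-\psi(y))$. Rotational epi-symmetrization: for $n\ge2$, $\psi_{\mathrm{rot}}$ is the unique function in $\mathrm{Conv}_{\mathrm c}(\mathbb{R}^n)$ with $\mathcal{L}\psi_{\mathrm{rot}}(x)=\int_{\mathrm{SO}(n)}\mathcal{L}\psi(\vartheta^{-1}x)\,\mathrm{d}\vartheta$ for all $x$ (Haar probability measure). For $n=1$, $\psi_{\mathrm{rot}}(x)=\tfrac12\,(\psi\,\square\,\psi^-)(2x)$, where $\psi^-(x)=\psi(-x)$ and $(\psi_1\,\square\,\psi_2)(x)=\inf_{y}(\psi_1(x-y)+\psi_2(y))$. For $f=e^{-\psi}$, $f_{\mathrm{rot}}=e^{-\psi_{\mathrm{rot}}}$. *)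

(* Defs.v *)
From HB Require Import structures.
From mathcomp Require Import all_boot all_order all_algebra.
From mathcomp Require Import all_classical all_reals all_analysis.

Set Implicit Arguments.
Unset Strict Implicit.
Unset Printing Implicit Defensive.

Import Order.TTheory GRing.Theory Num.Theory.
Import numFieldNormedType.Exports.

Local Open Scope classical_set_scope.
Local Open Scope ring_scope.

(* R^n is 'rV[R]_n. The library norm on 'rV[R]_n is the sup norm (same
   topology), hence the explicit inner product and Euclidean norm. *)
Definition dot {R : realType} {n : nat} (x y : 'rV[R]_n) : R :=
  \sum_(i < n) x ord0 i * y ord0 i.

Definition enorm {R : realType} {n : nat} (x : 'rV[R]_n) : R :=
  Num.sqrt (dot x x).

Definition econvex {R : realType} {n : nat} (psi : 'rV[R]_n -> \bar R) : Prop :=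
  forall (x y : 'rV[R]_n) (t : R), 0 < t < 1 ->
    (psi (t *: x + (1 - t) *: y)%R <= t%:E * psi x + (1 - t)%:E * psi y)%E.

Definition coercive {R : realType} {n : nat} (psi : 'rV[R]_n -> \bar R) : Prop :=
  forall A : R, exists r : R, forall x, r < enorm x -> (A%:E < psi x)%E.

Definition Convc {R : realType} {n : nat} : set ('rV[R]_n -> \bar R) :=
  [set psi | [/\ forall x, (-oo < psi x)%E,
                 exists x, (psi x < +oo)%E,
                 econvex psi,
                 lower_semicontinuous psi &
                 coercive psi]].

(* e^{-psi}, with e^{-oo} = 0; [fine] is harmless as psi never takes -oo. *)
Definition expN {R : realType} {n : nat} (psi : 'rV[R]_n -> \bar R)
    : 'rV[R]_n -> R :=
  fun x => fine (expeR (- psi x)%E).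

Definition LCc {R : realType} {n : nat} : set ('rV[R]_n -> R) :=
  [set expN psi | psi in Convc].

(* Functions in LCc are bounded, so this [sup] is a genuine supremum. *)
Definition asplund {R : realType} {n : nat} (f g : 'rV[R]_n -> R)
    : 'rV[R]_n -> R :=
  fun x => sup [set f y * g (x - y) | y in setT].

Definition homothety {R : realType} {n : nat} (lambda : R) (f : 'rV[R]_n -> R)
    : 'rV[R]_n -> R :=
  fun x => f (lambda^-1 *: x) `^ lambda.

Definition hypo_cvg {R : realType} {n : nat}
    (f_ : nat -> 'rV[R]_n -> R) (f : 'rV[R]_n -> R) : Prop :=
  forall x : 'rV[R]_n,
    (forall x_ : nat -> 'rV[R]_n, x_ @ \oo --> x ->
       (limn_esup (fun j => (f_ j (x_ j))%:E) <= (f x)%:E)%E) /\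
    (exists x_ : nat -> 'rV[R]_n,
       x_ @ \oo --> x /\ (fun j => f_ j (x_ j)) @ \oo --> f x).

(* Functionals on LCc are total maps of which only the values on LCc matter. *)
Definition nonneg_functional {R : realType} {n : nat}
    (G : ('rV[R]_n -> R) -> \bar R) : Prop :=
  (forall f, LCc f -> (0 <= G f)%E) /\
  ~ (exists f g, [/\ LCc f, LCc g, G f = 0%E & G g = +oo%E]).

Definition hypo_lsc {R : realType} {n : nat}
    (G : ('rV[R]_n -> R) -> \bar R) : Prop :=
  forall (f_ : nat -> 'rV[R]_n -> R) (f : 'rV[R]_n -> R),
    (forall j, LCc (f_ j)) -> LCc f -> hypo_cvg f_ f ->
    (G f <= limn_einf (fun j => G (f_ j)))%E.

Definition log_convex {R : realType} {n : nat}
    (G : ('rV[R]_n -> R) -> \bar R) : Prop :=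
  forall (f g : 'rV[R]_n -> R) (lambda : R),
    LCc f -> LCc g -> 0 < lambda < 1 ->
    (G (asplund (homothety lambda f) (homothety (1 - lambda) g))
      <= G f `^ lambda * G g `^ (1 - lambda)%R)%E.

Definition Ogroup {R : realType} {n : nat} : set 'M[R]_n :=
  [set theta | theta *m theta^T = 1%:M].

Definition SOgroup {R : realType} {n : nat} : set 'M[R]_n :=
  [set theta | Ogroup theta /\ \det theta = 1].

(* The column-vector action x |-> theta x, written on row vectors. *)
Definition rotate {R : realType} {n : nat} (theta : 'M[R]_n) (x : 'rV[R]_n)
    : 'rV[R]_n :=
  x *m theta^T.

Definition invariant_under {R : realType} {n : nat} (T : set 'M[R]_n)
    (G : ('rV[R]_n -> R) -> \bar R) : Prop :=
  forall f theta, LCc f -> T theta -> G (f \o rotate theta) = G f.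

Definition legendre {R : realType} {n : nat} (psi : 'rV[R]_n -> \bar R)
    : 'rV[R]_n -> \bar R :=
  fun x => ereal_sup [set ((dot x y)%:E - psi y)%E | y in setT].

Definition borelM (R : realType) (n : nat) :=
  g_sigma_algebraType (@open 'M[R]_n).

(* Haar probability measure of SO(n), as a Borel probability measure on the
   space of matrices that is carried by SO(n). *)
Definition haar_SO {R : realType} {n : nat} (mu : probability (borelM R n) R)
    : Prop :=
  mu SOgroup = 1%E /\
  forall (theta : 'M[R]_n) (A : set (borelM R n)),
    SOgroup theta -> measurable A -> A `<=` SOgroup ->
    mu [set theta *m X | X in (A : set 'M[R]_n)] = mu A.

(* n >= 2: the unique phi in Convc whose Legendre transform is the rotational
   mean of that of psi. *)
Definition epi_rot {R : realType} {n : nat} (mu : probability (borelM R n) R)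
    (psi : 'rV[R]_n -> \bar R) : 'rV[R]_n -> \bar R :=
  get [set phi | Convc phi /\
    forall x, legendre phi x =
      (\int[mu]_(theta in SOgroup)
         legendre psi (rotate (invmx (theta : 'M[R]_n)) x))%E].

Definition inf_conv {R : realType} {n : nat} (psi1 psi2 : 'rV[R]_n -> \bar R)
    : 'rV[R]_n -> \bar R :=
  fun x => ereal_inf [set (psi1 (x - y)%R + psi2 y)%E | y in setT].

(* Used in place of [epi_rot] for n = 1. *)
Definition epi_rot1 {R : realType} (psi : 'rV[R]_1 -> \bar R)
    : 'rV[R]_1 -> \bar R :=
  fun x => ((2^-1)%:E * inf_conv psi (fun y => psi (- y)%R) (2 *: x)%R)%E.

(* Main.v *)
Require Import Defs.
From HB Require Import structures.
From mathcomp Require Import all_boot all_order all_algebra.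
From mathcomp Require Import all_classical all_reals all_analysis.
From mathcomp Require Import perm measurable_realfun.
From mathcomp Require Import ring lra.

Set Implicit Arguments.
Unset Strict Implicit.
Unset Printing Implicit Defensive.

Import Order.TTheory GRing.Theory Num.Theory.
Import numFieldNormedType.Exports.

Local Open Scope classical_set_scope.
Local Open Scope ring_scope.

(** Write f = exp (- psi) and let h (y) be the mean of L psi (y theta) over the
    rotations theta, L being the Legendre transform; epi_rot psi is the
    function phi in Convc with L phi = h.

    On the Legendre side the Asplund combination of exp (- psi1) and
    exp (- psi2) with weights t and 1 - t is t L psi1 + (1 - t) L psi2, and
    log-convexity says that G of the combination is at most the larger of the
    two values of G.  Hence the functions chi with G (exp (- chi)) <= G f form
    a family S that contains all the psi o theta and whose Legendre
    transforms are stable under convex combination.  Since h is a mean of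
    Legendre transforms of members of S, and the mean of a vector-valued map
    lies in the closed convex hull of its values ([mean_in_closure]), for any
    finitely many points q_j some chi in S has L chi (q_j) as close as desired
    to h (q_j), also where h (q_j) = +oo ([mean_approx]).  Letting the q_j
    exhaust the rational points yields a sequence chi_k in S with
    L chi_k -> h on a dense set.

    Such dual convergence forces exp (- chi_k) to hypo-converge to
    exp (- phi) ([hypo_cvg_of_dual]).  The limsup half is the inequality
    chi_k (x_k) >= <q_j, x_k> - L chi_k (q_j) together with phi = L h.  For the
    recovery half, the points of the recovery sequence are proximal points p_k
    of chi_k at x: there chi_k (p_k) + 2K |p_k - x|^2 equals
    <x, y_k> - L chi_k (y_k) with y_k = 2K (x - p_k), and convexity together
    with a bound on L chi_k near 0 turns convergence on a dense set into the
    lower bound on L chi_k (y_k) that is needed.  Lower semicontinuity of G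
    then gives G (exp (- phi)) <= G f.

    The uniform bound on L chi near 0 ([growth]) is what makes the class of
    functions at hand closed under all operations: rotations preserve it, and
    convex combinations too.  Proximal points also prove the Fenchel-Moreau
    theorem ([fenchel_moreau]), which shows that phi exists ([epi_rotP]), and
    the projection onto a closed convex set used in [mean_in_closure].

    In dimension one exp (- epi_rot1 psi) is the midpoint Asplund combination
    of f and its reflection, so one application of log-convexity suffices. *)

(** * Euclidean norm on row vectors *)

Section Euclid.
Context {R : realType} {n : nat}.
Implicit Types (x y z v w : 'rV[R]_n) (a b c r t : R).

Lemma dotC x y : dot x y = dot y x.
Proof. by apply: eq_bigr => i _; rewrite mulrC. Qed.

Lemma dotDl x y z : dot (x + y) z = dot x z + dot y z.
Proof. by rewrite /dot -big_split; apply: eq_bigr => i _; rewrite mxE mulrDl. Qed.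

Lemma dotZl a x y : dot (a *: x) y = a * dot x y.
Proof. by rewrite /dot mulr_sumr; apply: eq_bigr => i _; rewrite mxE mulrA. Qed.

Lemma dotNl x y : dot (- x) y = - dot x y.
Proof. by rewrite -scaleN1r dotZl mulN1r. Qed.

Lemma dotDr x y z : dot z (x + y) = dot z x + dot z y.
Proof. by rewrite dotC dotDl !(dotC _ z). Qed.

Lemma dotZr a x y : dot x (a *: y) = a * dot x y.
Proof. by rewrite dotC dotZl dotC. Qed.

Lemma dotNr x y : dot x (- y) = - dot x y.
Proof. by rewrite dotC dotNl dotC. Qed.

Lemma dot0l x : dot 0 x = 0.
Proof. by rewrite -(scale0r 0) dotZl mul0r. Qed.

Lemma dot0r x : dot x 0 = 0.
Proof. by rewrite dotC dot0l. Qed.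

Definition dotE := (dotDl, dotDr, dotZl, dotZr, dotNl, dotNr, dot0l, dot0r).

Lemma dot_ge0 x : 0 <= dot x x.
Proof. by apply: sumr_ge0 => i _; rewrite -expr2 sqr_ge0. Qed.

Lemma dot_eq0 x : dot x x = 0 -> x = 0.
Proof.
move=> /eqP; rewrite psumr_eq0; last by move=> i _; rewrite -expr2 sqr_ge0.
move=> /allP x0; apply/rowP => i; rewrite mxE; apply/eqP.
by have := x0 i (mem_index_enum _); rewrite /= mulf_eq0 orbb.
Qed.

Lemma dot_mul x m (A : 'M[R]_(m, n)) (u : 'rV[R]_m) :
  dot (u *m A) x = dot u (x *m A^T).
Proof.
rewrite /dot.
under eq_bigr do rewrite mxE mulr_suml.
rewrite exchange_big /=; apply: eq_bigr => i _.
rewrite mxE mulr_sumr; apply: eq_bigr => j _.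
by rewrite mxE -mulrA (mulrC (A _ _)).
Qed.

Lemma enorm_ge0 x : 0 <= enorm x. Proof. exact: sqrtr_ge0. Qed.

Lemma enorm_sqr x : enorm x ^+ 2 = dot x x.
Proof. by rewrite sqr_sqrtr ?dot_ge0. Qed.

Lemma enorm0 : enorm (0 : 'rV[R]_n) = 0.
Proof. by rewrite /enorm dot0l sqrtr0. Qed.

Lemma enormN x : enorm (- x) = enorm x.
Proof. by rewrite /enorm !dotE opprK. Qed.

Lemma enormZ a x : enorm (a *: x) = `|a| * enorm x.
Proof.
by rewrite /enorm !dotE mulrA -expr2 sqrtrM ?sqr_ge0// sqrtr_sqr.
Qed.

(** Cauchy-Schwarz: expand [0 <= |b x - a y|^2] for [a = |x|], [b = |y|] and
    divide by [2 a b]. *)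
Lemma dot_le x y : dot x y <= enorm x * enorm y.
Proof.
set a := enorm x; set b := enorm y.
have [a0|a0] := eqVneq a 0.
  have -> : x = 0 by apply: dot_eq0; rewrite -enorm_sqr -/a a0 expr0n.
  by rewrite dot0l a0 mul0r.
have [b0|b0] := eqVneq b 0.
  have -> : y = 0 by apply: dot_eq0; rewrite -enorm_sqr -/b b0 expr0n.
  by rewrite dot0r b0 mulr0.
have : 0 <= dot (b *: x - a *: y) (b *: x - a *: y) by exact: dot_ge0.
have ap : 0 < a by rewrite lt_def a0 enorm_ge0.
have bp : 0 < b by rewrite lt_def b0 enorm_ge0.
rewrite !dotE (dotC y x) -!enorm_sqr -/a -/b => h.
have ab : 0 < a * b by exact: mulr_gt0.
rewrite -(ler_pM2l ab); lra.
Qed.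

Lemma dot_ge x y : - (enorm x * enorm y) <= dot x y.
Proof. by have := dot_le (- x) y; rewrite enormN dotNl lerNl. Qed.

Lemma enormD x y : enorm (x + y) <= enorm x + enorm y.
Proof.
rewrite -(@ler_pXn2r _ 2)// ?nnegrE ?addr_ge0 ?enorm_ge0//.
rewrite enorm_sqr !dotE sqrrD !enorm_sqr (dotC y x).
have := dot_le x y; lra.
Qed.

Lemma enormB_ge x y : enorm x - enorm y <= enorm (x - y).
Proof. by rewrite lerBlDr -{1}(subrK y x) enormD. Qed.

(** The topology of ['rV[R]_n] is defined by the sup norm.  This bound and the
    continuity of [enorm] make the Euclidean balls a base of neighbourhoods,
    so that all later estimates can use the rotation-invariant norm. *)
Lemma mx_norm_le_enorm x : `|x| <= enorm x.
Proof.
rewrite {1}/Num.norm /= mx_normrE; apply/bigmax_leP; split; first exact: enorm_ge0.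
move=> [i j] _ /=; rewrite ord1 -sqrtr_sqr /enorm ler_wsqrtr//.
rewrite /dot (bigD1 j)//= -expr2 lerDl sumr_ge0// => k _.
by rewrite -expr2 sqr_ge0.
Qed.

Lemma continuous_dot : continuous (fun x => dot x x).
Proof.
apply: (continuous_big (op := +%R)) => [|i _]; first exact: add_continuous.
move=> x; have c := @coord_continuous R 1 n ord0 i x.
exact: (cvgM c c).
Qed.

Lemma continuous_enorm : continuous (@enorm R n).
Proof.
move=> x; apply: (@continuous_comp _ _ _ (fun z => dot z z) Num.sqrt).
  exact: continuous_dot.
exact: sqrt_continuous.
Qed.

Lemma continuous_enormB x : continuous (fun z => enorm (z - x)).
Proof.
move=> z; apply: (@continuous_comp _ _ _ (fun z => z - x) enorm).
  apply: (@cvgB _ _ _ (nbhs z) _ id (fun=> x)); first exact: cvg_id.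
  exact: cvg_cst.
exact: continuous_enorm.
Qed.

Lemma near_enorm x r : 0 < r -> \forall z \near x, enorm (z - x) < r.
Proof.
move=> r0.
have : enorm (z - x) @[z --> x] --> (enorm (x - x) : R).
  exact: continuous_enormB.
by rewrite subrr enorm0 => /cvgr_lt; apply.
Qed.

Lemma nbhs_enorm x (A : set 'rV[R]_n) : nbhs x A ->
  exists2 r, 0 < r & forall z, enorm (z - x) < r -> A z.
Proof.
move=> /nbhs_ballP[r /= r0 rA]; exists r => // z zx; apply: rA.
by rewrite -ball_normE /=; apply: le_lt_trans (mx_norm_le_enorm _) _; rewrite -enormN opprB.
Qed.

Lemma compact_enorm_ball x r : compact [set z | enorm (z - x) <= r].
Proof.
apply: bounded_closed_compact.
  exists (`|x| + r); split => [|M hM z /= zx]; first by rewrite num_real.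
  rewrite -(subrK x z) addrC (le_trans (ler_normD _ _))// ltW//.
  apply: le_lt_trans hM; rewrite lerD2l.
  exact: le_trans (mx_norm_le_enorm _) zx.
have -> : [set z | enorm (z - x) <= r]
    = (fun z => enorm (z - x)) @^-1` [set a | a <= r] by [].
apply: closed_comp; last exact: closed_le.
by move=> z _; exact: continuous_enormB.
Qed.

End Euclid.

(** * Convexity, Legendre transform and lower semicontinuity *)

Section ConvexFunctions.
Context {R : realType} {n : nat}.
Implicit Types (x y z v w : 'rV[R]_n) (a b c r t : R) (psi chi : 'rV[R]_n -> \bar R).

(** Convexity tested against real majorants.  For functions that avoid [-oo]
    this is equivalent to [econvex] (see [econvex_intro]) and it keeps the
    computations in [R]. *)
Lemma econvex_le psi x y t a b : econvex psi -> 0 < t < 1 ->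
  (psi x <= a%:E)%E -> (psi y <= b%:E)%E ->
  (psi (t *: x + (1 - t) *: y)%R <= (t * a + (1 - t) * b)%:E)%E.
Proof.
move=> cpsi t01 xa yb; apply: le_trans (cpsi x y t t01) _.
move: t01 => /andP[t0 t1]; rewrite (EFinD (t * a)) !EFinM.
by apply: leeD; apply: lee_wpmul2l => //; rewrite lee_fin; lra.
Qed.

Lemma econvex_intro psi : (forall x, -oo < psi x)%E ->
  (forall x y t a b, 0 < t < 1 -> (psi x <= a%:E)%E -> (psi y <= b%:E)%E ->
    (psi (t *: x + (1 - t) *: y)%R <= (t * a + (1 - t) * b)%:E)%E) ->
  econvex psi.
Proof.
move=> Noo H x y t t01; have := H x y t _ _ t01.
have := Noo x; have := Noo y; move: t01 => /andP[t0 t1].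
have s0 : 0 < 1 - t by lra.
case: (psi x) => [a| |]//; case: (psi y) => [b| |]// _ _.
- by move=> /(_ _ _ (lexx _) (lexx _)).
- by move=> _; rewrite mulry gtr0_sg// mul1e addeC addye// leey.
- by move=> _; rewrite mulry gtr0_sg// mul1e addye// leey.
- by move=> _; rewrite !gt0_muley ?lte_fin// leey.
Qed.

(** Young's inequality, in a form where only real numbers are subtracted. *)
Lemma legendre_le psi y c :
  (legendre psi y <= c%:E)%E <-> forall z, ((dot y z - c)%:E <= psi z)%E.
Proof.
split=> [yc z|H].
  have : ((dot y z)%:E - psi z <= c%:E)%E.
    by apply: le_trans yc; apply: ereal_sup_ubound; exists z.
  by case: (psi z) => [b| |]//=; rewrite ?leey// -EFinB !lee_fin; lra.
apply: ge_ereal_sup => _ [z _ <-]; have := H z.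
by case: (psi z) => [b| |]//=; rewrite ?leNye// -EFinB !lee_fin; lra.
Qed.

Lemma legendre_gt psi y c :
  (c%:E < legendre psi y)%E <-> exists z, (psi z < (dot y z - c)%:E)%E.
Proof.
split=> [|[z zc]].
  rewrite ltNge => /negP H; apply: contrapT => N; apply/H/legendre_le => z.
  by rewrite leNgt; apply/negP => zc; apply: N; exists z.
rewrite ltNge; apply/negP => /legendre_le/(_ z).
by rewrite leNgt zc.
Qed.

Lemma legendre_gtNy psi y :
  (exists x, (psi x < +oo)%E) -> (-oo < legendre psi y)%E.
Proof.
move=> [x]; case E: (psi x) => [b| |]// _.
  apply: (@lt_trans _ _ (dot y x - b - 1)%:E); first exact: ltNyr.
  by apply/legendre_gt; exists x; rewrite E lte_fin; lra.
apply: (@lt_trans _ _ 0%:E); first exact: ltNyr.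
by apply/legendre_gt; exists x; rewrite E ltNyr.
Qed.

Lemma legendre_convex psi :
  (exists x, (psi x < +oo)%E) -> econvex (legendre psi).
Proof.
move=> prop; apply: econvex_intro => [x|x y t a b /andP[t0 t1]].
  exact: legendre_gtNy.
move=> /legendre_le xa /legendre_le yb; apply/legendre_le => z.
have := xa z; have := yb z; rewrite !dotE.
case: (psi z) => [c| |]//; rewrite ?leey// !lee_fin => h1 h2.
by nra.
Qed.

Lemma legendre_lsc psi : lower_semicontinuous (legendre psi).
Proof.
move=> y c /legendre_gt[z zc].
have [e e0 ze] : exists2 e, 0 < e & (psi z < (dot y z - c - e)%:E)%E.
  move: zc; case: (psi z) => [b| |]//.
    by rewrite lte_fin => h; exists ((dot y z - c - b) / 2); rewrite ?lte_fin; lra.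
  by move=> _; exists 1; rewrite ?ltNyr.
have n0 := enorm_ge0 z.
exists [set y' | enorm (y' - y) < e / (enorm z + 1)].
  by apply: near_enorm; apply: divr_gt0 => //; lra.
move=> y' /=; rewrite ltr_pdivlMr; last lra.
move=> yy; apply/legendre_gt; exists z; apply: lt_le_trans ze _.
have := dot_ge (y' - y) z; have := enorm_ge0 (y' - y).
rewrite lee_fin !dotE; nra.
Qed.

End ConvexFunctions.

Section LscCompact.
Context {T : topologicalType} {R : realType}.
Implicit Types (f : T -> \bar R) (K : set T).

(** Lower semicontinuity bounds [f] from below near each point of [K], and
    compactness makes the bound uniform. *)
Lemma lsc_compact_gt f K (F : set_system R) : Filter F ->
  lower_semicontinuous f -> compact K ->
  (forall p, K p -> exists2 a, (a%:E < f p)%E & \forall b \near F, b <= a) ->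
  \forall b \near F, forall p, K p -> (b%:E < f p)%E.
Proof.
move=> FF lscf /compact_near_coveringP/(_ _ F (fun b p => b%:E < f p)%E FF) cK H.
apply: cK => p Kp; have [a ap Fa] := H p Kp.
have [V Vp Va] := lscf p a ap; exists (V, [set b | b <= a]) => //=.
by move=> [q b] [/= Vq ba]; apply: le_lt_trans (Va _ Vq); rewrite lee_fin.
Qed.

(** If the infimum [i] were not attained, then [i < f] on [K], and the previous
    lemma with levels decreasing to [i] would give a lower bound of [f] on [K]
    larger than [i].  Levels decreasing to [-oo] show that [i] is finite. *)
Lemma lsc_compact_min f K x0 : (forall x, -oo < f x)%E ->
  lower_semicontinuous f -> compact K -> K x0 ->
  exists2 p, K p & forall z, K z -> (f p <= f z)%E.
Proof.
move=> Noo lscf cK Kx0.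
have [[m Km]|N] := pselect (exists m, forall z, K z -> (m%:E <= f z)%E); last first.
  exfalso; apply: N.
  have : \forall b \near -oo, forall p, K p -> (b%:E < f p)%E.
    apply: (@lsc_compact_gt f K (ninfty_nbhs R) _ lscf cK) => p Kp.
    have := Noo p; case: (f p) => [a| |]// _.
      by exists (a - 1); rewrite ?lte_fin; [lra|exists (a - 1); split => //= b /ltW].
    by exists 0; [exact: ltry|exists 0; split => //= b /ltW].
  move=> /filter_ex[b bK]; exists b => z /bK/ltW//.
set i := ereal_inf (f @` K).
have [[p Kp pi]|N] := pselect (exists2 p, K p & (f p <= i)%E).
  by exists p => // z Kz; apply: (le_trans pi); apply: ereal_inf_lbound; exists z.
have {}N p : K p -> (i < f p)%E.
  by move=> Kp; rewrite ltNge; apply/negP => pi; apply: N; exists p.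
exfalso.
have mi : (m%:E <= i)%E.
  by apply: le_ereal_inf_tmp => _ [z Kz <-]; exact: Km.
case E: i mi (N _ Kx0) => [j| |]// _; last by rewrite ltNge leey.
move=> _.
have : \forall b \near j^'+, forall p, K p -> (b%:E < f p)%E.
  apply: (@lsc_compact_gt f K (j^'+) _ lscf cK) => p Kp.
  have := N _ Kp; rewrite E; case: (f p) => [a| |]//.
    rewrite lte_fin => ja; exists ((j + a) / 2); first by rewrite lte_fin; lra.
    by apply: nbhs_right_le; lra.
  by move=> _; exists (j + 1); [exact: ltry|apply: nbhs_right_le; lra].
move=> H.
have [b [bj bK]] : exists b, j < b /\ forall p, K p -> (b%:E < f p)%E.
  by apply: (@filter_ex _ (j^'+)); apply: filterI => //; exact: nbhs_right_gt.
have : (b%:E <= i)%E by apply: le_ereal_inf_tmp => _ [z Kz <-]; exact/ltW/bK.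
by rewrite E lee_fin; lra.
Qed.

Lemma lsc_addr f (g : T -> R) : (forall x, -oo < f x)%E ->
  lower_semicontinuous f -> continuous g ->
  lower_semicontinuous (fun x => f x + (g x)%:E)%E.
Proof.
move=> Noo lscf cg x a ax.
have [b agb bf] : exists2 b, a - g x < b & (b%:E < f x)%E.
  move: ax (Noo x); case: (f x) => [r| |]//.
    rewrite -EFinD lte_fin => h _; exists ((a - g x + r) / 2); rewrite ?lte_fin; lra.
  by move=> _ _; exists (a - g x + 1); [lra|exact: ltry].
have [V Vx Vb] := lscf x b bf.
exists (V `&` [set y | a - b < g y]).
  apply: filterI => //; have := cg x => /cvgr_gt; apply; lra.
move=> y [/Vb]; have := Noo y; case: (f y) => [r| |]//= _.
  by rewrite -EFinD !lte_fin; lra.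
by move=> _ _; exact: ltry.
Qed.

End LscCompact.

Lemma le0_small {R : realType} (x y : R) :
  (forall t, 0 < t < 1 -> x <= t * y) -> x <= 0.
Proof.
move=> H; rewrite leNgt; apply/negP => x0.
have y0 : 0 < y by have := H (1/2); lra.
have d0 : 0 < 2 * (y + x) by lra.
have := H (x / (2 * (y + x))).
rewrite divr_gt0//= ltr_pdivrMr// mul1r mulrAC ler_pdivlMr//.
have : x < 2 * (y + x) by lra.
move=> -> /(_ isT); nra.
Qed.

(** * Proximal points and Fenchel-Moreau duality *)

Section Prox.
Context {R : realType} {n : nat}.
Implicit Types (x y z v w p : 'rV[R]_n) (a b c r t : R) (psi chi : 'rV[R]_n -> \bar R).

Definition closed_convex psi := [/\ forall x, (-oo < psi x)%E,
  exists x, (psi x < +oo)%E, econvex psi & lower_semicontinuous psi].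

(** Weaker than an affine minorant.  It is enough to make [chi + K |. - x|^2]
    coercive, and it survives averaging over rotations, where an affine
    minorant would call for a vector-valued integral. *)
Definition linear_minorant C chi :=
  forall z, ((- (C * (1 + enorm z)))%:E <= chi z)%E.

(** [p] is the proximal point of [chi] at [x], with [chi p = b].  Besides the
    minimality of [p], its first-order form is kept: [2K (x - p)] is
    a subgradient of [chi] at [p]. *)
Definition is_prox chi K x p b := [/\ chi p = b%:E,
  forall z, ((b + K * enorm (p - x) ^+ 2 - K * enorm (z - x) ^+ 2)%:E <= chi z)%E &
  forall z, ((b + dot ((2 * K) *: (x - p)) (z - p))%:E <= chi z)%E].

(** Compare [p] with [p + s (z - p)], divide by [s] and let [s] tend to 0. *)
Lemma prox_subgradient chi K x p b : 0 < K -> econvex chi -> chi p = b%:E ->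
  (forall z, ((b + K * enorm (p - x) ^+ 2 - K * enorm (z - x) ^+ 2)%:E <= chi z)%E) ->
  forall z, ((b + dot ((2 * K) *: (x - p)) (z - p))%:E <= chi z)%E.
Proof.
move=> K0 cvx pb pmin z.
have := pmin z; case E: (chi z) => [c| |]// _; last exact: leey.
rewrite lee_fin -subr_le0.
apply: (@le0_small _ _ (K * dot (z - p) (z - p))) => t t01.
have zc : (chi z <= c%:E)%E by rewrite E.
have pb' : (chi p <= b%:E)%E by rewrite pb.
have := le_trans (pmin _) (econvex_le cvx t01 zc pb').
rewrite lee_fin !enorm_sqr.
have -> : t *: z + (1 - t) *: p - x = (p - x) + t *: (z - p).
  by apply/rowP => i; rewrite !mxE; ring.
move: t01 => /andP[t0 t1].
have e : x - p = - (p - x) by rewrite opprB.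
rewrite e; move: (p - x) (z - p) => u v.
rewrite !dotE (dotC v u) => h.
rewrite -(ler_pM2l t0); lra.
Qed.

(** The quadratic term beats the linear minorant outside a large ball, and a
    lower semicontinuous function attains its minimum on that ball. *)
Lemma prox_exists chi C K x : 0 < K -> 0 <= C -> closed_convex chi ->
  linear_minorant C chi -> exists p b, is_prox chi K x p b.
Proof.
move=> K0 C0 [Noo [z0 z0fin] cvx lscc] minor.
pose F z := (chi z + (K * enorm (z - x) ^+ 2)%:E)%E.
have FNoo z : (-oo < F z)%E.
  by rewrite /F; have := Noo z; case: (chi z) => // b _; rewrite ltNyr.
have lscF : lower_semicontinuous F.
  apply: lsc_addr => // z; have c := @continuous_enormB R n x z.
  have ck := @cst_continuous 'rV[R]_n R K z.
  exact: (cvgM ck (cvgM c c)).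
have [b0 b0E] : exists b0, chi z0 = b0%:E.
  by move: z0fin (Noo z0); case: (chi z0) => // b _ _; exists b.
set s0 := enorm (z0 - x).
have s00 : 0 <= s0 := enorm_ge0 _.
set c0 := b0 + K * s0 ^+ 2.
have x0 := enorm_ge0 x.
(* beyond distance [rho] from [x], [K |z - x|^2] exceeds [C (1 + |z|)] by at
   least [c0] *)
set rho := 1 + s0 + (C * (2 + enorm x) + `|c0|) / K.
have q0 : 0 <= (C * (2 + enorm x) + `|c0|) / K.
  by apply: divr_ge0; [have := normr_ge0 c0; nra|lra].
have rho1 : 1 <= rho by rewrite /rho; lra.
have Krho : C * (2 + enorm x) + `|c0| <= K * rho.
  have -> : K * rho = K * (1 + s0) + (C * (2 + enorm x) + `|c0|).
    by rewrite /rho; field; rewrite gt_eqF.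
  by rewrite lerDr mulr_ge0//; lra.
have [|p pball pmin] := lsc_compact_min FNoo lscF
  (@compact_enorm_ball _ _ x rho) (_ : enorm (z0 - x) <= rho).
  by rewrite /= -/s0 /rho; lra.
have Fmin z : (F p <= F z)%E.
  have [/pmin//|zrho] := leP (enorm (z - x)) rho.
  have : (F p <= c0%:E)%E.
    have := pmin z0; rewrite {2}/F b0E -EFinD -/s0 -/c0; apply.
    rewrite /= -/s0 /rho; lra.
  move/le_trans; apply.
  rewrite /F; have := minor z; case: (chi z) => [b| |]//; last by rewrite addye ?leey.
  rewrite -EFinD !lee_fin => hb.
  have := enormD (z - x) x; rewrite subrK.
  set s := enorm (z - x) in zrho *; move: (enorm z) hb (enorm_ge0 z) => u hb u0 us.
  have c1 := ler_norm c0; have c2 := normr_ge0 c0.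
  have h1 : (C * (2 + enorm x) + `|c0|) * s <= K * s ^+ 2.
    rewrite expr2 mulrA ler_wpM2r//; first lra.
    apply: le_trans Krho _; rewrite ler_wpM2l//; lra.
  have s1 : 1 <= s by lra.
  have h2 : C * (1 + u) <= C * (1 + enorm x + s) by rewrite ler_wpM2l//; lra.
  have h3 : 0 <= C * (1 + enorm x) * (s - 1) by rewrite !mulr_ge0//; lra.
  have h4 : 0 <= `|c0| * (s - 1) by rewrite !mulr_ge0//; lra.
  lra.
have [b pb] : exists b, chi p = b%:E.
  have := Fmin z0; rewrite /F b0E; have := Noo p.
  by case: (chi p) => // b _ _; exists b.
have bmin z : ((b + K * enorm (p - x) ^+ 2 - K * enorm (z - x) ^+ 2)%:E <= chi z)%E.
  have := Fmin z; rewrite /F pb; case: (chi z) => [c| |]//; rewrite ?leey//.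
  by rewrite -!EFinD !lee_fin; lra.
exists p, b; split => //; exact: prox_subgradient.
Qed.

(** The subgradient [2K (x - p)] at [p] gives equality in Young's inequality. *)
Lemma prox_legendre chi K x p b : is_prox chi K x p b ->
  legendre chi ((2 * K) *: (x - p)) = (dot ((2 * K) *: (x - p)) p - b)%:E.
Proof.
move=> [pb _ sub]; apply/eqP; rewrite eq_le; apply/andP; split.
  apply/legendre_le => z; apply: le_trans (sub z).
  by rewrite lee_fin !dotE; lra.
rewrite leNgt; apply/negP => H.
have := ltW H; move/legendre_le => H1.
suff : exists c, c < dot ((2 * K) *: (x - p)) p - b /\ (legendre chi ((2 * K) *: (x - p)) <= c%:E)%E.
  by move=> [c [cb /legendre_le/(_ p)]]; rewrite pb lee_fin; lra.
move: H; case: (legendre _ _) => [c| |]//.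
  by rewrite lte_fin => h; exists c.
by move=> _; exists (dot ((2 * K) *: (x - p)) p - b - 1); rewrite leNye; split => //; lra.
Qed.

(** [chi] is at most its biconjugate.  The affine function that supports [chi] at
    the proximal point [p] takes at [x] the value [chi p + 2K |x - p|^2].  For
    [K] large this exceeds [c]: if [p] is close to [x], by lower
    semicontinuity of [chi] at [x]; otherwise because of the quadratic term. *)
Lemma fenchel_moreau chi C x c : 0 <= C -> closed_convex chi ->
  linear_minorant C chi -> (c%:E < chi x)%E ->
  exists y e, (legendre chi y <= e%:E)%E /\ c < dot x y - e.
Proof.
move=> C0 cl minor cx.
have [Noo _ _ lscc] := cl.
have [V /nbhs_enorm[r r0 rV] Vc] := lscc x c cx.
have x0 := enorm_ge0 x.
(* [K] is such that [K |p - x|^2] exceeds [c + C (1 + |p|)] as soon as [|p -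
   x| >= r] *)
pose K := (C + (C * (1 + enorm x) + `|c| + 1) / r) / r + 1.
have q0 : 0 <= (C * (1 + enorm x) + `|c| + 1) / r.
  by apply: divr_ge0; [have := normr_ge0 c; nra|lra].
have K0 : 0 < K.
  by rewrite /K; suff : 0 <= (C + (C * (1 + enorm x) + `|c| + 1) / r) / r by [lra]; apply: divr_ge0; lra.
have Kr : C + (C * (1 + enorm x) + `|c| + 1) / r <= K * r.
  have -> : K * r = C + (C * (1 + enorm x) + `|c| + 1) / r + r.
    by rewrite /K [LHS]mulrDl mul1r -mulrA mulVf ?mulr1// gt_eqF.
  lra.
have Krr : C * r + (C * (1 + enorm x) + `|c| + 1) <= K * r * r.
  apply: le_trans (_ : (C + (C * (1 + enorm x) + `|c| + 1) / r) * r <= _).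
    by rewrite [leRHS]mulrDl -[X in _ <= _ + X]mulrA mulVf ?mulr1// gt_eqF.
  by rewrite ler_pM2r.
have [p [b pr]] := prox_exists x K0 C0 cl minor.
exists ((2 * K) *: (x - p)), (dot ((2 * K) *: (x - p)) p - b).
rewrite (prox_legendre pr); split => //.
have [pb _ _] := pr.
rewrite (dotC x) opprB addrC -addrA -[X in _ < b + X]addrC.
have -> : dot ((2 * K) *: (x - p)) x - dot ((2 * K) *: (x - p)) p = 2 * K * enorm (x - p) ^+ 2.
  by rewrite enorm_sqr !dotE; ring.
have [pr1|pr1] := ltP (enorm (p - x)) r.
  have := Vc _ (rV _ pr1); rewrite pb lte_fin.
  have := sqr_ge0 (enorm (x - p)); nra.
have := minor p; rewrite pb lee_fin.
have := enormD (p - x) x; rewrite subrK.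
rewrite -(enormN (x - p)) opprB.
set s := enorm (p - x) in pr1 *.
move: (enorm p) (enorm_ge0 p) => u u0 us ub.
have h2 : C * (1 + u) <= C * (1 + enorm x + s) by rewrite ler_wpM2l//; lra.
have h1 : K * r * s <= K * s ^+ 2 by rewrite expr2 mulrA ler_wpM2r//; [lra|rewrite ler_pM2l].
have h3 : K * r * r <= K * r * s by rewrite ler_pM2l// mulr_gt0.
have h4 : C * s <= K * r * s by rewrite ler_wpM2r//; lra.
have := ler_norm c; nra.
Qed.

End Prox.

(** * Linear growth and weighted infimal convolution *)

Section Growth.
Context {R : realType} {n : nat}.
Implicit Types (x y z v w p : 'rV[R]_n) (a b c r t : R) (psi chi : 'rV[R]_n -> \bar R).

(** Linear growth of [psi], expressed by its Legendre transform: rotations and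
    convex combinations of Legendre transforms visibly preserve it. *)
Definition growth d M psi := forall y, dot y y <= d -> (legendre psi y <= M%:E)%E.

(** The best affine minorant at [z] has slope [Num.sqrt d * z / |z|]. *)
Lemma growth_ge d M psi z : 0 <= d -> growth d M psi ->
  ((Num.sqrt d * enorm z - M)%:E <= psi z)%E.
Proof.
move=> d0 gr; set y := (Num.sqrt d / enorm z) *: z.
have [z0|z0] := eqVneq (enorm z) 0.
  have := gr 0; rewrite dot0l => /(_ d0)/legendre_le/(_ z).
  by rewrite dot0l z0 mulr0.
have := gr y; rewrite /y !dotE -!enorm_sqr => H.
have {H} := H _; have -> : Num.sqrt d / enorm z * (Num.sqrt d / enorm z * enorm z ^+ 2) = d.
  by rewrite -[in RHS](sqr_sqrtr d0); field.
move=> /(_ (lexx _))/legendre_le/(_ z).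
by rewrite dotZl -enorm_sqr expr2 mulrA divfK.
Qed.

Lemma growth_ge_cst d M psi z : 0 <= d -> growth d M psi -> ((- M)%:E <= psi z)%E.
Proof.
move=> d0 gr; have := gr 0; rewrite dot0l => /(_ d0)/legendre_le/(_ z).
by rewrite dot0l sub0r.
Qed.

Lemma growth_minorant d M psi : 0 <= d -> growth d M psi -> linear_minorant `|M| psi.
Proof.
move=> d0 gr z; apply: le_trans (growth_ge_cst z d0 gr).
rewrite lee_fin lerN2; have := ler_norm M; have := normr_ge0 M; have := enorm_ge0 z; nra.
Qed.

Lemma growth_Convc d M psi : 0 < d -> closed_convex psi -> growth d M psi -> Convc psi.
Proof.
move=> d0 [Noo prop cvx lscp] gr; split => // A.
have s0 : 0 < Num.sqrt d by rewrite sqrtr_gt0.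
exists ((A + M) / Num.sqrt d) => z; rewrite ltr_pdivrMr// => h.
apply: lt_le_trans (growth_ge z (ltW d0) gr); rewrite lte_fin; lra.
Qed.

(** Outside a ball around a point [x0] of finiteness the value exceeds
    [psi x0 + 1], so convexity along the rays from [x0] forces linear growth;
    inside the ball [psi] is bounded below by compactness. *)
Lemma Convc_growth psi : Convc psi ->
  exists d M, 0 < d /\ growth d M psi.
Proof.
move=> [Noo [x0 x0fin] cvx lscp coer].
have [b b0] : exists b, psi x0 = b%:E.
  by move: x0fin (Noo x0); case: (psi x0) => // b _ _; exists b.
have [r rA] := coer (b + 1).
set rho := `|r| + enorm x0 + 1.
have r0 := normr_ge0 r; have rr := ler_norm r; have e0 := enorm_ge0 x0.
have rho0 : 0 < rho by rewrite /rho; lra.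
have [|p _ pmin] := lsc_compact_min Noo lscp
  (@compact_enorm_ball _ _ x0 rho) (_ : enorm (x0 - x0) <= rho).
  by rewrite subrr enorm0 ltW.
have [m pm] : exists m, psi p = m%:E.
  have := pmin x0; rewrite /= subrr enorm0 => /(_ (ltW rho0)).
  by have := Noo p; rewrite b0; case: (psi p) => // m; exists m.
have mb : m <= b.
  by have := pmin x0; rewrite /= subrr enorm0 pm b0 lee_fin; apply; exact: ltW.
have lin z : ((m - 1 + enorm (z - x0) / rho)%:E <= psi z)%E.
  have [zr|zr] := leP (enorm (z - x0)) rho.
    apply: le_trans (pmin z zr); rewrite pm lee_fin.
    suff : enorm (z - x0) / rho <= 1 by lra.
    by rewrite ler_pdivrMr// mul1r.
  have := Noo z; case E : (psi z) => [c| |]// _; last by rewrite leey.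
  set s := enorm (z - x0) in zr *.
  have s0 : 0 < s by lra.
  have t01 : 0 < rho / s < 1 by rewrite divr_gt0//= ltr_pdivrMr// mul1r.
  have /(econvex_le cvx t01) H : (psi z <= c%:E)%E by rewrite E.
  have /H : (psi x0 <= b%:E)%E by rewrite b0.
  have /rA : r < enorm ((rho / s) *: z + (1 - rho / s) *: x0).
    have -> : (rho / s) *: z + (1 - rho / s) *: x0 = (rho / s) *: (z - x0) - (- x0).
      by apply/rowP => i; rewrite !mxE; ring.
    apply: lt_le_trans (enormB_ge _ _); rewrite enormN enormZ -/s.
    by rewrite ger0_norm ?divr_ge0 ?ltW// divfK ?gt_eqF// /rho; lra.
  move=> h1 h2; have := lt_le_trans h1 h2; rewrite !lte_fin => h.
  have h3 : 1 < (rho / s) * (c - b) by lra.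
  have : 1 * (s / rho) <= (rho / s) * (c - b) * (s / rho).
    by rewrite ler_pM2r ?divr_gt0// ltW.
  have -> : (rho / s) * (c - b) * (s / rho) = c - b.
    by field; rewrite !gt_eqF.
  by rewrite lee_fin; lra.
exists (rho^-1 ^+ 2), (enorm x0 / rho - (m - 1)); split; first by rewrite exprn_gt0// invr_gt0.
move=> y; rewrite -enorm_sqr ler_pXn2r ?nnegrE ?enorm_ge0// ?invr_ge0 ?(ltW rho0)// => yr.
apply/legendre_le => z; apply: le_trans (lin z).
rewrite lee_fin -{1}(subrK x0 z) dotDr.
have := dot_le y (z - x0); have := dot_le y x0.
have : enorm y * enorm (z - x0) <= rho^-1 * enorm (z - x0) by rewrite ler_wpM2r ?enorm_ge0.
have : enorm y * enorm x0 <= rho^-1 * enorm x0 by rewrite ler_wpM2r ?enorm_ge0.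
lra.
Qed.

Lemma Convc_closed_convex psi : Convc psi -> closed_convex psi.
Proof. by move=> [? ? ? ? _]. Qed.

End Growth.

Section Winf.
Context {R : realType} {n : nat}.
Implicit Types (x y z u v w : 'rV[R]_n) (a b c r t d M : R) (psi chi : 'rV[R]_n -> \bar R).

(** Minus the logarithm of the Asplund combination, with weights [t] and
    [1 - t], of [exp (- psi1)] and [exp (- psi2)] (see [asplund_winf]). *)
Definition winf t psi1 psi2 : 'rV[R]_n -> \bar R := fun x =>
  ereal_inf [set (t%:E * psi1 (t^-1 *: y) + (1 - t)%:E * psi2 ((1 - t)^-1 *: (x - y)))%E | y in setT].

Variables (t : R) (psi1 psi2 : 'rV[R]_n -> \bar R).
Hypotheses (t01 : 0 < t < 1).
Hypotheses (Noo1 : forall x, (-oo < psi1 x)%E) (Noo2 : forall x, (-oo < psi2 x)%E).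

Let t0 : 0 < t. Proof. by case/andP : t01. Qed.
Let s0 : 0 < 1 - t. Proof. by case/andP : t01; lra. Qed.

(** Substitute [y = t u]: the infimum runs over all ways of writing [x] as
    [t u + (1 - t) v]. *)
Lemma winf_lt x c : (winf t psi1 psi2 x < c%:E)%E <->
  exists u v a b, [/\ x = t *: u + (1 - t) *: v, (psi1 u <= a%:E)%E,
    (psi2 v <= b%:E)%E & t * a + (1 - t) * b < c].
Proof.
split.
  move=> /ereal_inf_lt[_ [y _ <-]].
  set u := t^-1 *: y; set v := (1 - t)^-1 *: _ => h.
  exists u, v.
  have := Noo1 u; have := Noo2 v; move: h.
  case E1 : (psi1 u) => [a| |]//; case E2 : (psi2 v) => [b| |]//.
  - move=> h _ _; exists a, b; split => //.
    by rewrite /u /v !scalerA !divff ?gt_eqF// !scale1r addrC subrK.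
  - by rewrite (gt0_muley (_ : 0 < (1 - t)%:E)%E) ?lte_fin.
  - by rewrite gt0_muley ?lte_fin.
  - by rewrite !gt0_muley ?lte_fin.
move=> [u [v [a [b [-> ua vb abc]]]]].
apply: le_lt_trans (_ : (t * a + (1 - t) * b)%:E < _)%E; last by rewrite lte_fin.
apply: ge_ereal_inf.
exists (t%:E * psi1 u + (1 - t)%:E * psi2 v)%E; last first.
  rewrite (EFinD (t * a)) !EFinM; apply: leeD; apply: lee_wpmul2l => //; rewrite lee_fin ltW//.
exists (t *: u) => //.
have -> : t *: u + (1 - t) *: v - t *: u = (1 - t) *: v by rewrite addrC addKr.
by rewrite !scalerA !mulVf ?gt_eqF// !scale1r.
Qed.

Lemma winf_ge m x : (forall z, (m%:E <= psi1 z)%E) -> (forall z, (m%:E <= psi2 z)%E) ->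
  (m%:E <= winf t psi1 psi2 x)%E.
Proof.
move=> h1 h2; rewrite leNgt; apply/negP => /winf_lt[u [v [a [b [_ ua vb]]]]].
have := le_trans (h1 u) ua; have := le_trans (h2 v) vb; rewrite !lee_fin.
have := t0; have := s0; nra.
Qed.

(** This and [winf_legendre_ge] say that the Legendre transform of [winf] is
    the convex combination of the Legendre transforms, in real-valued form. *)
Lemma winf_legendre_le y a b : (legendre psi1 y <= a%:E)%E ->
  (legendre psi2 y <= b%:E)%E ->
  (legendre (winf t psi1 psi2) y <= (t * a + (1 - t) * b)%:E)%E.
Proof.
move=> /legendre_le h1 /legendre_le h2; apply/legendre_le => z.
rewrite leNgt; apply/negP => /winf_lt[u [v [a' [b' [-> ua vb]]]]].
have := le_trans (h1 u) ua; have := le_trans (h2 v) vb; rewrite !lee_fin !dotE.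
have := t0; have := s0; nra.
Qed.

Lemma legendre_ge_approx psi y a e : 0 < e -> (a%:E <= legendre psi y)%E ->
  exists z, (psi z <= (dot y z - a + e)%:E)%E.
Proof.
move=> e0 h.
have : ((a - e)%:E < legendre psi y)%E.
  by apply: lt_le_trans h; rewrite lte_fin; lra.
move=> /legendre_gt[z /ltW zz]; exists z; apply: le_trans zz _.
by rewrite lee_fin; lra.
Qed.

Lemma winf_legendre_ge y a b : (a%:E <= legendre psi1 y)%E ->
  (b%:E <= legendre psi2 y)%E ->
  ((t * a + (1 - t) * b)%:E <= legendre (winf t psi1 psi2) y)%E.
Proof.
move=> h1 h2; apply/lee_subgt0Pr => e e0.
have e2 : 0 < e / 2 by lra.
have [u ua] := legendre_ge_approx e2 h1; have [v vb] := legendre_ge_approx e2 h2.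
apply/ltW; rewrite -EFinB; apply/legendre_gt; exists (t *: u + (1 - t) *: v).
apply/winf_lt; exists u, v, (dot y u - a + e / 2), (dot y v - b + e / 2).
split; [by []|exact: ua|exact: vb|].
rewrite !dotE; lra.
Qed.

(** By linear growth only the [u] in a fixed ball compete in the infimum at
    points near [x].  The competing value is jointly lower semicontinuous in
    the point and [u], so compactness of the ball gives a uniform bound. *)
Lemma winf_lsc d M : 0 < d -> growth d M psi1 -> growth d M psi2 ->
  lower_semicontinuous psi1 -> lower_semicontinuous psi2 ->
  lower_semicontinuous (winf t psi1 psi2).
Proof.
move=> d0 g1 g2 l1 l2 x a' xa'.
have [a a'a xa] : exists2 a, a' < a & (a%:E < winf t psi1 psi2 x)%E.
  move: xa'; case: (winf _ _ _ x) => [c| |]//.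
    by rewrite lte_fin => h; exists ((a' + c) / 2); rewrite ?lte_fin; lra.
  by exists (a' + 1); [lra|exact: ltry].
have sd : 0 < Num.sqrt d by rewrite sqrtr_gt0.
set rho := (`|a| + `|M| + 1) / (t * Num.sqrt d).
have td : 0 < t * Num.sqrt d by rewrite mulr_gt0// t0.
pose P (z u : 'rV[R]_n) := forall p q, (psi1 u <= p%:E)%E ->
  (psi2 ((1 - t)^-1 *: (z - t *: u)) <= q%:E)%E -> a < t * p + (1 - t) * q.
have : \forall z \near x, [set u | enorm (u - 0) <= rho] `<=` P z.
  have /compact_near_coveringP cK := @compact_enorm_ball R n 0 rho.
  apply: (cK _ (nbhs x) P) => u _; set v := (1 - t)^-1 *: (x - t *: u).
  have [p [q [pu qv pqa]]] : exists p q,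
      [/\ (p%:E < psi1 u)%E, (q%:E < psi2 v)%E & a <= t * p + (1 - t) * q].
    have H p q : (psi1 u <= p%:E)%E -> (psi2 v <= q%:E)%E -> a < t * p + (1 - t) * q.
      move=> up vq; rewrite ltNge; apply/negP => le.
      move: xa; rewrite ltNge => /negP; apply.
      apply/lee_addgt0Pr => e e0; rewrite -EFinD ltW//; apply/winf_lt.
      exists u, v, p, q; split => //; last lra.
      by rewrite scalerA divff ?gt_eqF// scale1r addrC subrK.
    move: (Noo1 u) (Noo2 v) H; case: (psi1 u) => [p| |]//; case: (psi2 v) => [q| |]// _ _ H.
    - have := H _ _ (lexx _) (lexx _) => h.
      exists (p - (t * p + (1 - t) * q - a)), (q - (t * p + (1 - t) * q - a)).
      by split; rewrite ?lte_fin; lra.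
    - exists (p - 1), ((a - t * (p - 1)) / (1 - t)); split; rewrite ?ltry ?lte_fin//; first lra.
      by rewrite [X in _ + X]mulrC divfK ?gt_eqF//; lra.
    - exists ((a - (1 - t) * (q - 1)) / t), (q - 1); split; rewrite ?ltry ?lte_fin//; first lra.
      by rewrite [t * _]mulrC divfK ?gt_eqF//; lra.
    - by exists a, a; split; rewrite ?ltry//; lra.
  have [V Vu Vp] := l1 _ _ pu; have [W /nbhs_enorm[r r0 rW] Wq] := l2 _ _ qv.
  have r1 : 0 < r * (1 - t) / 2 by rewrite divr_gt0// mulr_gt0// s0.
  exists (V `&` [set u' | enorm (u' - u) < r * (1 - t) / 2], [set z | enorm (z - x) < r * (1 - t) / 2]).
    by split; [apply: filterI => //; exact: near_enorm|exact: near_enorm].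
  move=> [u' z] [/= [Vu' uu'] zx] p' q' u'p v'q.
  have := lt_le_trans (Vp _ Vu') u'p.
  have /rW/Wq vq : enorm ((1 - t)^-1 *: (z - t *: u') - v) < r.
    have -> : (1 - t)^-1 *: (z - t *: u') - v = (1 - t)^-1 *: ((z - x) + (- t) *: (u' - u)).
      by rewrite /v -scalerBr; congr (_ *: _); apply/rowP => i; rewrite !mxE; ring.
    rewrite enormZ gtr0_norm ?invr_gt0// mulrC ltr_pdivrMr//.
    apply: le_lt_trans (enormD _ _) _; rewrite enormZ normrN gtr0_norm//.
    have := enorm_ge0 (u' - u); move: t01 => /andP[? ?]; nra.
  have := lt_le_trans vq v'q; rewrite !lte_fin; have := t0; have := s0; nra.
move=> near; exists [set z | [set u | enorm (u - 0) <= rho] `<=` P z] => // z Pz.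
apply: (@lt_le_trans _ _ a%:E); first by rewrite lte_fin.
rewrite leNgt; apply/negP => /winf_lt[u [v [p [q [zuv up vq pqa]]]]].
suff : a < t * p + (1 - t) * q by lra.
have [ur|ur] := leP (enorm u) rho.
  apply: (Pz u) => //=; first by rewrite subr0.
  have -> : z - t *: u = (1 - t) *: v by rewrite zuv addrC addKr.
  by rewrite scalerA mulVf ?gt_eqF// scale1r.
have := le_trans (growth_ge u (ltW d0) g1) up.
have := le_trans (growth_ge_cst v (ltW d0) g2) vq.
rewrite !lee_fin => h1 h2.
move: ur; rewrite /rho ltr_pdivrMr// => ur.
have h3 : (1 - t) * - M <= (1 - t) * q by rewrite ler_wpM2l// ltW// s0.
have h4 : t * (Num.sqrt d * enorm u - M) <= t * p by rewrite ler_wpM2l// ltW// t0.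
have := ler_norm a; have := ler_norm M; lra.
Qed.

Lemma winf_closed_convex d M : 0 < d -> growth d M psi1 -> growth d M psi2 ->
  closed_convex psi1 -> closed_convex psi2 -> closed_convex (winf t psi1 psi2).
Proof.
move=> d0 g1 g2 [_ [x1 p1] c1 l1] [_ [x2 p2] c2 l2].
have Noo x : (-oo < winf t psi1 psi2 x)%E.
  apply: (@lt_le_trans _ _ (- M)%:E); first exact: ltNyr.
  by apply: winf_ge => z; apply: growth_ge_cst (ltW d0) _.
split => //.
- exists (t *: x1 + (1 - t) *: x2).
  have [a pa] : exists a, (psi1 x1 <= a%:E)%E.
    by move: p1 (Noo1 x1); case: (psi1 x1) => // a; exists a.
  have [b pb] : exists b, (psi2 x2 <= b%:E)%E.
    by move: p2 (Noo2 x2); case: (psi2 x2) => // b; exists b.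
  apply: (@lt_trans _ _ (t * a + (1 - t) * b + 1)%:E); last exact: ltry.
  by apply/winf_lt; exists x1, x2, a, b; split => //; lra.
- apply: econvex_intro => // x y s a b /andP[st0 st1] xa yb.
  apply/lee_addgt0Pr => e e0; rewrite -EFinD ltW//.
  have /winf_lt[u [v [p [q [-> up vq pq]]]]] : (winf t psi1 psi2 x < (a + e)%:E)%E.
    by apply: le_lt_trans xa _; rewrite lte_fin; lra.
  have /winf_lt[u' [v' [p' [q' [-> up' vq' pq']]]]] : (winf t psi1 psi2 y < (b + e)%:E)%E.
    by apply: le_lt_trans yb _; rewrite lte_fin; lra.
  have s01 : 0 < s < 1 by rewrite st0.
  apply/winf_lt; exists (s *: u + (1 - s) *: u'), (s *: v + (1 - s) *: v'),
    (s * p + (1 - s) * p'), (s * q + (1 - s) * q'); split.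
  + by apply/rowP => i; rewrite !mxE; ring.
  + exact: econvex_le.
  + exact: econvex_le.
  + have : s * (t * p + (1 - t) * q) < s * (a + e) by rewrite ltr_pM2l.
    have : (1 - s) * (t * p' + (1 - t) * q') < (1 - s) * (b + e) by rewrite ltr_pM2l//; lra.
    lra.
- exact: winf_lsc d0 g1 g2 l1 l2.
Qed.

Lemma winf_growth d M : growth d M psi1 -> growth d M psi2 -> growth d M (winf t psi1 psi2).
Proof.
move=> g1 g2 y yd; have := winf_legendre_le (g1 y yd) (g2 y yd).
by have -> : t * M + (1 - t) * M = M by ring.
Qed.

End Winf.

(** * Asplund sums and the one-dimensional case *)

Section Asplund.
Context {R : realType}.

Definition expNe (v : \bar R) : R := fine (expeR (- v)%E).

Lemma expNe_ge0 v : 0 <= expNe v.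
Proof. by rewrite /expNe; case: v => //= r; exact: expR_ge0. Qed.

Lemma le_expNe v w : (-oo < v)%E -> (v <= w)%E -> expNe w <= expNe v.
Proof.
case: v => [a| |]// _; case: w => [b| |]//; rewrite /expNe /= ?expR_ge0//.
by rewrite lee_fin ler_expR lerN2.
Qed.

Lemma expNeM v w (t : R) : (-oo < v)%E -> (-oo < w)%E -> 0 < t < 1 ->
  expNe v `^ t * expNe w `^ (1 - t) = expNe (t%:E * v + (1 - t)%:E * w)%E.
Proof.
move=> v0 w0 /andP[t0 t1].
have H u s : 0 < s -> (-oo < u)%E -> expNe u `^ s = expNe (s%:E * u)%E.
  move=> s0; case: u => [a| |]// _; rewrite /expNe /=.
    by rewrite -expRM mulNr mulrC.
  by rewrite gt0_muley ?lte_fin//= powR0// gt_eqF.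
rewrite !H//; last lra.
have {}t1 : 0 < 1 - t by lra.
case: v v0 => [a| |]// _; case: w w0 => [b| |]// _; rewrite ?gt0_muley ?lte_fin// /expNe /=.
- by rewrite opprD expRD.
- by rewrite mulr0.
- by rewrite mul0r.
- by rewrite mulr0.
Qed.

(** [v |-> exp (- v)] is decreasing and continuous.  The bound [m] makes the
    left-hand side a supremum of a bounded set of reals. *)
Lemma sup_expNe (S : set (\bar R)) (m : R) : S !=set0 ->
  (forall v, S v -> (m%:E <= v)%E) -> sup [set expNe v | v in S] = expNe (ereal_inf S).
Proof.
move=> [v0 Sv0] Sm.
have mi : (m%:E <= ereal_inf S)%E by apply: le_ereal_inf_tmp.
have iNoo : (-oo < ereal_inf S)%E by apply: lt_le_trans mi; exact: ltNyr.
have ub v : S v -> expNe v <= expNe (ereal_inf S).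
  by move=> Sv; apply: le_expNe => //; exact: ereal_inf_lbound.
have hs : has_sup [set expNe v | v in S].
  split; first by exists (expNe v0), v0.
  by exists (expNe (ereal_inf S)) => _ [v Sv <-]; exact: ub.
apply/eqP; rewrite eq_le; apply/andP; split.
  by apply: ge_sup; [case: hs|move=> _ [v Sv <-]; exact: ub].
rewrite leNgt; apply/negP => h.
set s := sup _ in h.
have s0 : 0 <= s.
  apply: le_trans (expNe_ge0 v0) _; apply: ub_le_sup; first by case: hs.
  by exists v0.
have [c [sc cS]] : exists c, s < c /\ c <= expNe (ereal_inf S) /\ c < expNe (ereal_inf S).
  exists ((s + expNe (ereal_inf S)) / 2); lra.
have c0 : 0 < c by lra.
have : (ereal_inf S < (- ln c)%:E)%E.
  move: cS iNoo; case: (ereal_inf S) => [i| |]//.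
    rewrite /expNe /= => -[_ ci] _; rewrite lte_fin.
    by rewrite ltrNr -ltr_expR lnK ?posrE.
  by rewrite /expNe /= => -[_ ci] _; have := lt_trans c0 ci; rewrite ltxx.
move=> /ereal_inf_lt[v Sv vc].
have : c <= expNe v.
  have : (-oo < v)%E by apply: lt_le_trans (Sm v Sv); exact: ltNyr.
  case: v Sv vc => [a| |]// Sv; rewrite lte_fin /expNe /= => h1 _.
  by rewrite -[leLHS]lnK ?posrE// ler_expR; lra.
have : expNe v <= s by apply: ub_le_sup; [case: hs|exists v].
lra.
Qed.

Lemma asplund_winf n (t m : R) (psi1 psi2 : 'rV[R]_n -> \bar R) : 0 < t < 1 ->
  (forall z, (m%:E <= psi1 z)%E) -> (forall z, (m%:E <= psi2 z)%E) ->
  asplund (homothety t (expN psi1)) (homothety (1 - t) (expN psi2)) =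
  expN (winf t psi1 psi2).
Proof.
move=> t01 m1 m2; apply/funext => x; rewrite /asplund /expN -/(expNe _) /winf.
have N1 z : (-oo < psi1 z)%E by apply: lt_le_trans (m1 z); exact: ltNyr.
have N2 z : (-oo < psi2 z)%E by apply: lt_le_trans (m2 z); exact: ltNyr.
rewrite -(@sup_expNe _ m).
- congr (sup _); apply/seteqP; split=> [_ [y _ <-]|_ [_ [y _ <-] <-]].
    eexists; first by exists y. 
    by rewrite -expNeM.
  by exists y => //; rewrite /homothety -expNeM.
- by eexists; exists 0.
- move=> _ [y _ <-]; move: t01 => /andP[t0 t1].
  have := m1 (t^-1 *: y); have := m2 ((1 - t)^-1 *: (x - y)).
  have := N1 (t^-1 *: y); have := N2 ((1 - t)^-1 *: (x - y)).
  case: (psi1 _) => [a| |]//; case: (psi2 _) => [b| |]// _ _;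
    rewrite ?gt0_muley ?lte_fin ?subr_gt0// ?leey// !lee_fin; nra.
Qed.

Lemma poweR_mean (g a b : \bar R) (t : R) : 0 < t < 1 -> (0 <= a)%E -> (0 <= b)%E ->
  (a <= g)%E -> (b <= g)%E -> (a `^ t * b `^ (1 - t)%R <= g)%E.
Proof.
move=> /andP[t0 t1]; have s0 : 0 < 1 - t by lra.
case: g => [g| |]; last 2 first.
- by move=> *; rewrite leey.
- by case: a.
case: a => [a| |]//; case: b => [b| |]//; rewrite !lee_fin => a0 b0 ag bg.
change ((a `^ t * b `^ (1 - t))%:E <= g%:E)%E; rewrite lee_fin.
have -> : g = g `^ t * g `^ (1 - t).
  by rewrite -powRD ?subrKC ?powRr1//; [lra|rewrite gt_eqF ?implybT//; lra].
apply: ler_pM; rewrite ?powR_ge0//; apply: ge0_ler_powR; rewrite ?nnegrE//; lra.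
Qed.

(** Sublevel sets of [G] are stable under Asplund combination. *)
Lemma log_convex_winf n (G : ('rV[R]_n -> R) -> \bar R) (t d M : R) (g : \bar R)
   (psi1 psi2 : 'rV[R]_n -> \bar R) : 0 < t < 1 -> 0 < d ->
  nonneg_functional G -> log_convex G -> 
  closed_convex psi1 -> growth d M psi1 -> closed_convex psi2 -> growth d M psi2 ->
  (G (expN psi1) <= g)%E -> (G (expN psi2) <= g)%E -> (G (expN (winf t psi1 psi2)) <= g)%E.
Proof.
move=> t01 d0 [G0 _] lG c1 g1 c2 g2 G1 G2.
rewrite -(@asplund_winf _ _ (- M))//; last 2 first.
- by move=> z; exact: growth_ge_cst (ltW d0) g1.
- by move=> z; exact: growth_ge_cst (ltW d0) g2.
have L1 : LCc (expN psi1) by exists psi1 => //; exact: growth_Convc g1.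
have L2 : LCc (expN psi2) by exists psi2 => //; exact: growth_Convc g2.
apply: le_trans (lG _ _ _ L1 L2 t01) _.
by apply: poweR_mean => //; exact: G0.
Qed.

(** Replace [y] by [2 (x - y)] in the infimal convolution. *)
Lemma epi_rot1_winf (psi : 'rV[R]_1 -> \bar R) :
  (forall x, -oo < psi x)%E ->
  epi_rot1 psi = winf 2^-1 psi (fun y => psi (- y)%R).
Proof.
move=> Noo; apply/funext => x; rewrite /epi_rot1 /inf_conv /winf.
have e : 1 - 2^-1 = 2^-1 :> R by lra.
have tw : (2 : R) != 0 by lra.
have half y z : ((2^-1 : R)%:E * (psi y + psi z) =
    (2^-1)%:E * psi y + (2^-1)%:E * psi z)%E.
  by rewrite muleDr//; move: (Noo y) (Noo z); case: (psi y) => //; case: (psi z).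
rewrite e -ereal_inf_pZl ?invr_gt0//; congr ereal_inf; apply/seteqP; split.
  move=> _ [_ [y _ <-] <-]; exists (x - 2^-1 *: y) => //.
  rewrite half invrK scalerBr scalerA divff// scale1r.
  congr (_ + _ * psi _)%E.
  by rewrite opprB addrC subrK scalerA divff// scale1r.
move=> _ [y _ <-]; eexists; first by exists (2 *: (x - y)).
rewrite half invrK; congr (_ * psi _ + _)%E.
by rewrite scalerBr opprB addrC subrK.
Qed.

(** [epi_rot1 psi] is the midpoint combination of [psi] and its reflection, and
    [G] takes the same value at both. *)
Lemma epi_rot1_le (G : ('rV[R]_1 -> R) -> \bar R) (psi : 'rV[R]_1 -> \bar R) :
  nonneg_functional G -> log_convex G -> invariant_under Ogroup G -> Convc psi ->
  (G (expN (epi_rot1 psi)) <= G (expN psi))%E.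
Proof.
move=> [G0 _] lG iG cpsi.
have [Noo _ _ _ _] := cpsi.
have [d [M [d0 gr]]] := Convc_growth cpsi.
have t01 : 0 < (2^-1 : R) < 1 by lra.
have lpsi : LCc (expN psi) by exists psi.
have OI : Ogroup (- 1%:M : 'M[R]_1).
  rewrite /Ogroup /= mulNmx mul1mx.
  by rewrite -[RHS]opprK; congr (- _); rewrite linearN /= trmx1.
have e : expN psi \o rotate (- 1%:M) = expN (fun y => psi (- y)).
  by apply/funext => y; rewrite /= /rotate linearN /= trmx1 /expN mulmxN mulmx1.
have Gm : G (expN (fun y => psi (- y))) = G (expN psi) by rewrite -e iG.
have lpsim : LCc (expN (fun y => psi (- y))).
  exists (fun y => psi (- y)) => //; case: cpsi => _ [x0 x0fin] cvx lscp coer; split => //.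
  - by exists (- x0); rewrite opprK.
  - by move=> x y t t1; rewrite opprD -!scalerN; exact: cvx.
  - move=> x a ax; have [V /nbhs_enorm[r r0 rV] Va] := lscp _ _ ax.
    exists [set z | enorm (z - x) < r]; first exact: near_enorm.
    by move=> z zx; apply/Va/rV; rewrite -opprD enormN.
  - by move=> A; have [r rA] := coer A; exists r => x; rewrite -enormN; exact: rA.
rewrite epi_rot1_winf// -(@asplund_winf _ _ (- M))//; last 2 first.
- by move=> z; exact: growth_ge_cst (ltW d0) gr.
- by move=> z; exact: growth_ge_cst (ltW d0) gr.
apply: le_trans (lG _ _ _ lpsi lpsim t01) _.
by apply: poweR_mean => //; rewrite ?Gm//; exact: G0.
Qed.

End Asplund.

(** * Integrals of functions bounded below, and means of vector-valued maps *)

Section EventualBounds.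
Context {R : realType}.
Implicit Types (u w : \bar R) (v : nat -> \bar R) (c : R).
Local Open Scope ereal_scope.

Lemma lee_from_below u w : (forall c, c%:E < u -> c%:E <= w) -> u <= w.
Proof.
move=> H; rewrite leNgt; apply/negP => wu.
have [c wc cu] : exists2 c : R, w < c%:E & c%:E < u.
  move: wu; case: u {H} => [a| |]; case: w => [b| |]//=.
  - by rewrite lte_fin => h; exists ((a + b) / 2)%R; rewrite lte_fin; lra.
  - by move=> _; exists (a - 1)%R; rewrite ?ltNyr ?lte_fin//; lra.
  - by move=> _; exists (b + 1)%R; rewrite ?ltry ?lte_fin//; lra.
  - by move=> _; exists 0%R; rewrite ?ltNyr ?ltry.
by have := H c cu; rewrite leNgt wc.
Qed.

Lemma limn_esup_le v u : (\forall k \near \oo, v k <= u) -> limn_esup v <= u.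
Proof.
move=> H; apply: ge_ereal_inf.
exists (ereal_sup (v @` [set k | v k <= u])); first by exists [set k | v k <= u].
by apply: ge_ereal_sup => _ [k /= ku <-].
Qed.

Lemma limn_einf_le v u : (forall k, v k <= u) -> limn_einf v <= u.
Proof.
by move=> H; apply: le_trans (limn_einf_sup v) _; apply: limn_esup_le; exact: nearW.
Qed.

(** Levels strictly below [u] are tested, which also covers [u = +oo]. *)
Lemma le_limn_einf v u : (forall c, c%:E < u -> \forall k \near \oo, c%:E < v k) ->
  u <= limn_einf v.
Proof.
move=> H; apply: lee_from_below => c cu.
rewrite /limn_einf leeNr; apply: limn_esup_le.
by apply: filterS (H c cu) => k /ltW; rewrite leeN2.
Qed.

End EventualBounds.

Section BoundedBelow.
Context {d} {T : measurableType d} {R : realType} (mu : probability T R).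
Variables (D : set T) (mD : measurable D) (muD : mu D = 1%E).
Implicit Types (U V W : T -> \bar R) (a b c C : R).
Local Open Scope ereal_scope.

Definition bounded_below C U := forall x, D x -> (- C)%:E <= U x.

Lemma integral_prob_cst c : \int[mu]_(x in D) c%:E = c%:E.
Proof.
transitivity (c%:E * mu D); first exact: integral_cst.
by rewrite muD mule1.
Qed.

Lemma bounded_below_addr C U x : bounded_below C U -> D x -> 0 <= U x + C%:E.
Proof.
move=> UC Dx; have := UC x Dx; case: (U x) => [r| |]//; rewrite ?leey//.
by rewrite -EFinD !lee_fin; lra.
Qed.

(** Reduces integrals of functions bounded below to integrals of nonnegative
    functions.  Add the integral of the negative part, which is finite, to
    both sides: [(U + C) + U^-] and [U^+ + C] agree pointwise. *)
Lemma integral_shift C U : (0 <= C)%R -> measurable_fun D U -> bounded_below C U ->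
  \int[mu]_(x in D) (U x + C%:E) = \int[mu]_(x in D) U x + C%:E.
Proof.
move=> C0 mU UC.
have mUC : measurable_fun D (fun x => U x + C%:E).
  by apply: emeasurable_funD => //; exact: measurable_cst.
have mp : measurable_fun D (funepos U) by exact: measurable_funepos.
have mn : measurable_fun D (funeneg U) by exact: measurable_funeneg.
have nC x : D x -> U^\- x <= C%:E.
  move=> Dx; have := UC x Dx; rewrite unlock.
  have C0' : 0 <= C%:E by rewrite lee_fin.
  case: (U x) => [r| |]//= h; rewrite ge_max C0' ?leNye// andbT.
  by rewrite !lee_fin in h *; lra.
(* the finite term can then be cancelled *)
have E : \int[mu]_(x in D) (U x + C%:E) + \int[mu]_(x in D) U^\- x =
    \int[mu]_(x in D) U^\+ x + C%:E.
  rewrite -[in RHS](integral_prob_cst C) -!ge0_integralD//.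
  - apply: eq_integral => x /set_mem Dx; have := UC x Dx.
    rewrite !unlock; case: (U x) => [r| |]//= _; last first.
      by rewrite (@max_r _ _ -oo) ?leNye// (@max_l _ _ +oo) ?leey// !addye// adde0.
    rewrite -!EFin_max -!EFinD; congr EFin.
    have [h|h] := leP r 0%R.
      by rewrite (@max_l _ _ (- r)%R) ?oppr_ge0//; ring.
    by rewrite (@max_r _ _ (- r)%R) ?oppr_le0 ?(ltW h)//; ring.
  - by move=> x Dx; exact: bounded_below_addr.
rewrite [in RHS]integralE.
have : \int[mu]_(x in D) U^\- x \is a fin_num.
  rewrite ge0_fin_numE; last by apply: integral_ge0 => x _; exact: funeneg_ge0.
  apply: (@le_lt_trans _ _ (\int[mu]_(x in D) C%:E)); last by rewrite integral_prob_cst ltry.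
  by apply: ge0_le_integral.
have p0 : 0 <= \int[mu]_(x in D) U^\+ x by apply: integral_ge0.
have s0 : 0 <= \int[mu]_(x in D) (U x + C%:E).
  by apply: integral_ge0 => x Dx; exact: bounded_below_addr.
move: E p0 s0; case: (\int[mu]_(x in D) (U x + C%:E)) => [s| |]//;
  case: (\int[mu]_(x in D) U^\- x) => [k| |]//; case: (\int[mu]_(x in D) U^\+ x) => [p| |]//.
by rewrite -!EFinD => -[e] _ _ _; congr EFin; lra.
Qed.

Lemma integral_le_bounded_below C U V : (0 <= C)%R -> measurable_fun D U -> measurable_fun D V ->
  bounded_below C U -> (forall x, D x -> U x <= V x) ->
  \int[mu]_(x in D) U x <= \int[mu]_(x in D) V x.
Proof.
move=> C0 mU mV UC UV.
have VC : bounded_below C V by move=> x Dx; exact: le_trans (UC x Dx) (UV x Dx).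
rewrite -(@leeD2rE _ C%:E)// -!integral_shift//; apply: ge0_le_integral => //.
- by move=> x Dx; exact: bounded_below_addr.
- by apply: emeasurable_funD => //; exact: measurable_cst.
- by apply: emeasurable_funD => //; exact: measurable_cst.
- by move=> x Dx; apply: leeD2r; exact: UV.
Qed.

Lemma integral_ge_bounded_below C U : (0 <= C)%R -> measurable_fun D U ->
  bounded_below C U -> (- C)%:E <= \int[mu]_(x in D) U x.
Proof.
move=> C0 mU UC; rewrite -[leLHS]integral_prob_cst.
by apply: (integral_le_bounded_below C0).
Qed.

Lemma integral_convex_bounded_below C U V W (t a b : R) : (0 <= C)%R ->
  measurable_fun D U -> measurable_fun D V -> measurable_fun D W ->
  bounded_below C U -> bounded_below C V -> bounded_below C W -> (0 < t < 1)%R ->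
  (forall x, D x -> W x <= t%:E * U x + (1 - t)%:E * V x) ->
  \int[mu]_(x in D) U x <= a%:E -> \int[mu]_(x in D) V x <= b%:E ->
  \int[mu]_(x in D) W x <= (t * a + (1 - t) * b)%:E.
Proof.
move=> C0 mU mV mW UC VC WC /andP[t0 t1] WUV Ua Vb.
have s0 : (0 <= 1 - t)%R by lra.
have mC F : measurable_fun D F -> measurable_fun D (fun x => F x + C%:E).
  by move=> mF; apply: emeasurable_funD => //; exact: measurable_cst.
have mt (k : R) F : measurable_fun D F -> measurable_fun D (fun x => k%:E * (F x + C%:E)).
  by move=> mF; apply: emeasurable_funM; [exact: measurable_cst|exact: mC].
rewrite -(@leeD2rE _ C%:E)// -integral_shift//.
apply: (@le_trans _ _ (\int[mu]_(x in D) (t%:E * (U x + C%:E) + (1 - t)%:E * (V x + C%:E)))).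
  apply: ge0_le_integral => //.
  - by move=> x Dx; exact: bounded_below_addr.
  - exact: mC.
  - by apply: emeasurable_funD; exact: mt.
  - move=> x Dx; have := WUV x Dx; have := UC x Dx; have := VC x Dx; have := WC x Dx.
    have tE : 0 < t%:E by rewrite lte_fin.
    have sE : 0 < (1 - t)%:E by rewrite lte_fin; lra.
    case: (U x) => [u| |]//; case: (V x) => [v| |]//; rewrite ?addye// ?gt0_muley// ?leey//.
    by case: (W x) => [w| |]// _ _ _; rewrite !lee_fin => h; lra.
rewrite ge0_integralD//; first last.
- exact: mt.
- by move=> x Dx; apply: mule_ge0; rewrite ?lee_fin//; exact: bounded_below_addr.
- exact: mt.
- by move=> x Dx; apply: mule_ge0; rewrite ?lee_fin ?(ltW t0)//; exact: bounded_below_addr.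
rewrite !ge0_integralZl_EFin ?(ltW t0)//; try exact: mC;
  try by move=> x Dx; exact: bounded_below_addr.
rewrite !integral_shift//.
apply: (@le_trans _ _ (t%:E * (a + C)%:E + (1 - t)%:E * (b + C)%:E)).
  by apply: leeD; apply: lee_wpmul2l; rewrite ?lee_fin ?(ltW t0)// EFinD leeD2r.
by rewrite -!EFinM -!EFinD lee_fin; lra.
Qed.

Lemma fatou_bounded_below C U (V : nat -> T -> \bar R) a : (0 <= C)%R ->
  measurable_fun D U -> (forall k, measurable_fun D (V k)) ->
  bounded_below C U -> (forall k, bounded_below C (V k)) ->
  (forall x c, D x -> c%:E < U x -> \forall k \near \oo, c%:E < V k x) ->
  (forall k, \int[mu]_(x in D) V k x <= a%:E) ->
  \int[mu]_(x in D) U x <= a%:E.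
Proof.
move=> C0 mU mV UC VC UV Va.
have mC F : measurable_fun D F -> measurable_fun D (fun x => F x + C%:E).
  by move=> mF; apply: emeasurable_funD => //; exact: measurable_cst.
rewrite -(@leeD2rE _ C%:E)// -integral_shift//.
have F := @fatou _ _ _ mu D mD (fun k x => V k x + C%:E) (fun k => mC _ (mV k))
  (fun k x Dx => bounded_below_addr (VC k) Dx).
apply: le_trans (le_trans F _).
  apply: ge0_le_integral => //.
  - by move=> x Dx; exact: bounded_below_addr.
  - exact: mC.
  - apply: measurableT_comp => //; apply: measurable_fun_limn_esup => k.
    by apply: measurableT_comp => //; exact: mC.
  - move=> x Dx; apply: le_limn_einf => c cU.
    have : (c - C)%:E < U x.
      by move: cU; case: (U x) => [u| |]//; rewrite ?ltry// -EFinD !lte_fin; lra.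
    move=> /(UV x _ Dx); apply: filterS => k.
    by case: (V k x) => [v| |]//; rewrite ?addye ?ltry// -?EFinD !lte_fin; lra.
apply: limn_einf_le => k; rewrite integral_shift//.
by apply: leeD2r.
Qed.

Lemma integrable_bounded_below C U : (0 <= C)%R -> measurable_fun D U -> bounded_below C U ->
  \int[mu]_(x in D) U x < +oo -> mu.-integrable D U.
Proof.
move=> C0 mU UC Uoo; apply/integrableP; split => //.
have mC F : measurable_fun D F -> measurable_fun D (fun x => F x + C%:E).
  by move=> mF; apply: emeasurable_funD => //; exact: measurable_cst.
apply: (@le_lt_trans _ _ (\int[mu]_(x in D) (U x + (2 * C)%:E))).
  apply: ge0_le_integral => //.
  - exact: measurableT_comp.
  - by apply: emeasurable_funD => //; exact: measurable_cst.
  - move=> x Dx; have := UC x Dx; case: (U x) => [u| |]//=; rewrite ?addye ?leey//.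
    by rewrite -EFinD !lee_fin ler_norml => h; apply/andP; split; lra.
rewrite integral_shift//; [by rewrite lte_add_pinfty// ltry|lra|].
by move=> x Dx; apply: le_trans (UC x Dx); rewrite lee_fin; lra.
Qed.

(** Truncations of [U] at height [k] are integrable, and by Fatou's lemma their
    integrals are unbounded. *)
Lemma integrable_minorant C U K : (0 <= C)%R -> measurable_fun D U -> bounded_below C U ->
  \int[mu]_(x in D) U x = +oo ->
  exists w : T -> R, [/\ mu.-integrable D (EFin \o w), forall x, D x -> (w x)%:E <= U x &
    K%:E <= \int[mu]_(x in D) (w x)%:E].
Proof.
move=> C0 mU UC Uoo.
pose V (k : nat) x := mine (U x) k%:R%:E.
have mV k : measurable_fun D (V k).
  by apply: measurable_mine => //; exact: measurable_cst.
have VC k : bounded_below C (V k).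
  move=> x Dx; rewrite le_min UC//= lee_fin.
  by apply: (@le_trans _ _ 0%R); rewrite ?oppr_le0.
have [k kV] : exists k, K%:E <= \int[mu]_(x in D) V k x.
  apply: contrapT => N.
  suff : \int[mu]_(x in D) U x <= K%:E by rewrite Uoo.
  apply: (fatou_bounded_below C0 mU mV UC VC) => [x c Dx cU|k].
    near=> k; rewrite lt_min cU lte_fin.
    near: k; exact: nbhs_infty_gtr.
  by rewrite leNgt; apply/negP => Kk; apply: N; exists k; exact: ltW.
have Vfin x : D x -> V k x \is a fin_num.
  move=> Dx; rewrite fin_numE; apply/andP; split.
    by have := VC k x Dx; case: (V k x).
  have : V k x <= k%:R%:E by rewrite ge_min lexx orbT.
  by case: (V k x).
have VE : {in D, V k =1 EFin \o (fun x => fine (V k x))}.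
  by move=> x /set_mem Dx; rewrite /= fineK// Vfin.
exists (fun x => fine (V k x)); split.
- apply: eq_integrable VE _ => //.
  apply: (@integrable_bounded_below C) => //.
  apply: (@le_lt_trans _ _ (\int[mu]_(x in D) k%:R%:E)).
    apply: (@integral_le_bounded_below C) => //.
    by move=> x Dx; rewrite ge_min lexx orbT.
  by rewrite integral_prob_cst ltry.
- by move=> x Dx; rewrite fineK ?Vfin// ge_min lexx.
- by rewrite -(eq_integral _ _ VE).
Unshelve. all: by end_near. Qed.

(** The mean of a map with values in a convex set is in the closure of the set.
    Let [p] be the projection of the mean [c] onto the closure, obtained as a
    proximal point of its indicator.  Then [<c - p, u - p> <= 0] almost
    everywhere, and integrating gives [|c - p|^2 <= 0]. *)
Lemma mean_in_closure m (V : set 'rV[R]_m) (u : T -> 'rV[R]_m) (c : 'rV[R]_m) :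
  (forall v w t, V v -> V w -> (0 < t < 1)%R -> V (t *: v + (1 - t) *: w)%R) ->
  (forall i, mu.-integrable D (fun x => (u x ord0 i)%:E)) ->
  (forall i, \int[mu]_(x in D) (u x ord0 i)%:E = (c ord0 i)%:E) ->
  {ae mu, forall x, D x -> V (u x)} ->
  forall e, (0 < e)%R -> exists2 v, V v & (enorm (v - c) < e)%R.
Proof.
move=> cV iu uc [N [mN N0 subN]].
have VN x : (D `\` N) x -> V (u x).
  by move=> [Dx Nx]; apply: contrapT => Vx; apply: Nx; apply: subN => /= /(_ Dx).
pose cl z := forall e, (0 < e)%R -> exists2 v, V v & (enorm (v - z) < e)%R.
have Vcl v : V v -> cl v by move=> Vv e e0; exists v => //; rewrite subrr enorm0.
suff : cl c by [].
have [x0 Dx0] : (D `\` N) !=set0.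
  apply/set0P/eqP => DN; have : mu D <= mu N.
    apply: le_measure; rewrite ?inE// => x Dx; apply: contrapT => Nx.
    by have : (D `\` N) x by []; rewrite DN.
  by rewrite N0 muD leNgt lte01.
(* the indicator function of the closure *)
pose chi z : \bar R := if pselect (cl z) then 0 else +oo.
have chi_cl z : chi z < +oo -> cl z by rewrite /chi; case: pselect.
have chiV z : V z -> chi z = 0 by rewrite /chi; case: pselect => // N' /Vcl.
have chi0 z : 0 <= chi z by rewrite /chi; case: pselect => // _; rewrite leey.
have cc : closed_convex chi.
  split.
  - by move=> z; apply: lt_le_trans (chi0 z); rewrite ltNyr.
  - by exists (u x0); rewrite chiV ?ltry//; exact: VN.
  - apply: econvex_intro => [z|x y t a b /andP[t0 t1]].
      by apply: lt_le_trans (chi0 z); rewrite ltNyr.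
    move=> xa yb; have a0 := le_trans (chi0 x) xa; have b0 := le_trans (chi0 y) yb.
    have clx : cl x by apply: chi_cl; apply: le_lt_trans xa _; rewrite ltry.
    have cly : cl y by apply: chi_cl; apply: le_lt_trans yb _; rewrite ltry.
    have s0 : (0 < 1 - t)%R by lra.
    suff : cl (t *: x + (1 - t) *: y)%R.
      rewrite /chi; case: pselect => // clz _; move: a0 b0; rewrite !lee_fin => a0 b0.
      by rewrite addr_ge0// mulr_ge0// ltW.
    move=> e e0; have [v Vv vx] := clx e e0.
    have [w Vw wy] := cly e e0.
    exists (t *: v + (1 - t) *: w)%R; first by apply: cV => //; rewrite t0.
    have -> : (t *: v + (1 - t) *: w - (t *: x + (1 - t) *: y) = t *: (v - x) + (1 - t) *: (w - y))%R.
      by apply/rowP => i; rewrite !mxE; ring.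
    apply: le_lt_trans (enormD _ _) _; rewrite !enormZ !gtr0_norm//; nra.
  - move=> x a ax.
    have [clx|nclx] := pselect (cl x).
      exists setT; first exact: filterT.
      move=> y _; apply: lt_le_trans (chi0 y).
      by move: ax; rewrite /chi; case: pselect.
    have [e [e0 eV]] : exists e, (0 < e)%R /\ forall v, V v -> (e <= enorm (v - x))%R.
      apply: contrapT => H; apply: nclx => e e0; apply: contrapT => H'.
      apply: H; exists e; split => // v Vv; rewrite leNgt; apply/negP => ve.
      by apply: H'; exists v.
    exists [set y | (enorm (y - x) < e / 2)%R]; first by apply: near_enorm; lra.
    move=> y /= yx; rewrite /chi; case: pselect => [cly|ncly]; last exact: ltry.
    have e2 : (0 < e / 2)%R by lra.
    exfalso; have [v Vv vy] := cly _ e2; have := eV v Vv.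
    have := enormD (v - y) (y - x); rewrite addrA subrK; lra.
have minor : linear_minorant 0 chi by move=> z; rewrite mul0r oppr0.
have [p [b [pb _ sub]]] := prox_exists c ltr01 (lexx _) cc minor.
have clp : cl p by apply: chi_cl; rewrite pb ltry.
have b0 : b = 0%R by apply: EFin_inj; rewrite -pb /chi; case: pselect.
suff -> : c = p by [].
set w := ((2 * 1) *: (c - p))%R in sub.
have wle x : (D `\` N) x -> (dot w (u x) <= dot w p)%R.
  move=> /VN Vx; have := sub (u x); rewrite chiV// lee_fin b0 dotDr dotNr; lra.
have idot : mu.-integrable D (fun x => (dot w (u x))%:E).
  under eq_fun do rewrite /dot -sumEFin.
  apply: integrable_sum => // i _.
  by under eq_fun do rewrite EFinM; apply: integrableZl.
have Edot : \int[mu]_(x in D) (dot w (u x))%:E = (dot w c)%:E.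
  under eq_integral do rewrite /dot -sumEFin.
  rewrite integral_sum//; last first.
    by move=> i; under eq_fun do rewrite EFinM; apply: integrableZl.
  rewrite /dot -sumEFin; apply: eq_bigr => i _.
  under eq_integral do rewrite EFinM.
  by rewrite integralZl// uc.
have mDN : measurable (D `\` N) by exact: measurableD.
have : (dot w c)%:E <= (dot w p)%:E.
  rewrite -Edot (negligible_integral mN mD idot N0).
  have -> : (dot w p)%:E = \int[mu]_(x in D `\` N) (dot w p)%:E.
    rewrite -(negligible_integral mN mD _ N0) ?integral_prob_cst//.
    exact: finite_measure_integrable_cst.
  apply: le_integral => //.
  - by apply: integrableS idot => //; exact: subDsetl.
  - by apply: finite_measure_integrable_cst.
  - by move=> x /set_mem xDN; rewrite lee_fin; exact: wle.
rewrite lee_fin => h; apply/eqP; rewrite -subr_eq0; apply/eqP/dot_eq0/eqP.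
rewrite eq_le dot_ge0 andbT; move: h; rewrite /w !dotE; lra.
Qed.

End BoundedBelow.

(** * The rotation group *)

Section RotationGroup.
Context {R : realType} {n : nat}.
Implicit Types (theta : 'M[R]_n) (x y z : 'rV[R]_n).

Lemma lsc_borelM_measurable (g : 'M[R]_n -> \bar R) : lower_semicontinuous g ->
  measurable_fun setT (g : borelM R n -> \bar R).
Proof.
move=> lscg; apply: (measurability _ (ErealGenOInfty.measurableE R)) => //.
move=> _ [_ [a ->] <-]; rewrite setTI.
apply: sub_sigma_algebra; rewrite preimage_itvoy.
by move/lower_semicontinuousP : lscg; exact.
Qed.

Lemma continuous_borelM_measurable (g : 'M[R]_n -> R) : continuous g ->
  measurable_fun setT (g : borelM R n -> R).
Proof.
move=> cg; apply/measurable_EFinP; apply: lsc_borelM_measurable => x a.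
rewrite /= lte_fin => ax; exists [set y | a < g y] => //.
by have := cg x => /cvgr_gt; apply.
Qed.

Lemma continuous_det : continuous (fun theta : 'M[R]_n => \det theta).
Proof.
apply: (continuous_big (op := +%R)) => [|s _]; first exact: add_continuous.
move=> theta.
have c1 := @cst_continuous 'M[R]_n R ((-1) ^+ s) theta.
have c2 : continuous (fun theta : 'M[R]_n => \prod_(i < n) theta i (s i)).
  apply: (@continuous_big R 'I_n *%R 1 xpredT (@mul_continuous R)) => i _.
  exact: coord_continuous.
exact: (cvgM c1 (c2 theta)).
Qed.

(** [SOgroup] is the zero set of one continuous function, the sum of the
    squares of the defects in its defining equations. *)
Lemma measurable_SOgroup : measurable (@SOgroup R n : set (borelM R n)).
Proof.
pose F theta := \sum_(i < n) \sum_(j < n) ((theta *m theta^T) i j - (1%:M : 'M[R]_n) i j) ^+ 2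
  + (\det theta - 1) ^+ 2.
have cF : continuous F.
  have sq (f : 'M[R]_n -> R) (c : R) : continuous f -> continuous (fun t => (f t - c) ^+ 2).
    move=> cf t; have c1 := @cst_continuous 'M[R]_n R c t.
    have c2 : (f t0 - c) @[t0 --> t] --> (f t - c) := cvgB (cf t) c1.
    apply: (@continuous_comp _ _ _ (fun t => f t - c) (fun a : R => a ^+ 2)); first exact: c2.
    exact: exprn_continuous.
  have c1 : continuous (fun theta => \sum_(i < n) \sum_(j < n)
      ((theta *m theta^T) i j - (1%:M : 'M[R]_n) i j) ^+ 2).
    apply: (continuous_big (op := +%R)) => [|i _]; first exact: add_continuous.
    apply: (continuous_big (op := +%R)) => [|j _]; first exact: add_continuous.
    apply: (sq (fun theta => (theta *m theta^T) i j)).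
    have -> : (fun theta => (theta *m theta^T) i j) =
        (fun theta => \sum_(k < n) theta i k * theta j k) :> ('M[R]_n -> R).
      by apply/funext => t; rewrite mxE; apply: eq_bigr => k _; rewrite mxE.
    apply: (continuous_big (op := +%R)) => [|k _]; first exact: add_continuous.
    by move=> t; have a1 := @coord_continuous R n n i k t;
      have a2 := @coord_continuous R n n j k t; exact: (cvgM a1 a2).
  have c2 := sq _ 1 continuous_det.
  by move=> t; exact: (cvgD (c1 t) (c2 t)).
have -> : @SOgroup R n = setT `&` F @^-1` [set 0].
  apply/seteqP; split => [t [tO td]|t [_]].
    split => //=; rewrite /F td subrr expr0n addr0 big1// => i _.
    by rewrite big1// => j _; rewrite tO subrr expr0n.
  rewrite /= /F => /eqP; rewrite paddr_eq0 ?sqr_ge0//; last first.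
    by apply: sumr_ge0 => i _; apply: sumr_ge0 => j _; exact: sqr_ge0.
  rewrite sqrf_eq0 subr_eq0 psumr_eq0; last by move=> i _; apply: sumr_ge0 => j _; exact: sqr_ge0.
  move=> /andP[/allP H /eqP td]; split => //; apply/matrixP => i j.
  have := H i (mem_index_enum _); rewrite /= psumr_eq0; last by move=> k _; exact: sqr_ge0.
  by move=> /allP/(_ j (mem_index_enum _)) /=; rewrite sqrf_eq0 subr_eq0 => /eqP.
exact: (continuous_borelM_measurable cF).
Qed.

Lemma Ogroup_tr theta : Ogroup theta -> theta^T *m theta = 1%:M.
Proof. exact: mulmx1C. Qed.

Lemma SOgroup_tr theta : SOgroup theta -> SOgroup theta^T.
Proof.
move=> [tO td]; split; last by rewrite det_tr.
by rewrite /Ogroup /= trmxK; exact: Ogroup_tr.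
Qed.

Lemma rotate_invmx theta x : SOgroup theta -> rotate (invmx theta) x = x *m theta.
Proof.
move=> [tO _]; rewrite /rotate; congr (_ *m _).
have u : theta \in unitmx by case: (mulmx1_unit tO).
have -> : invmx theta = theta^T by rewrite -[RHS]mul1mx -(mulVmx u) -mulmxA tO mulmx1.
by rewrite trmxK.
Qed.

Lemma dot_rotate theta x y : Ogroup theta -> dot (x *m theta) (y *m theta) = dot x y.
Proof. by move=> tO; rewrite dot_mul -mulmxA tO mulmx1. Qed.

Lemma enorm_rotate theta x : Ogroup theta -> enorm (x *m theta) = enorm x.
Proof. by move=> tO; rewrite /enorm dot_rotate. Qed.

Lemma legendre_rotate (psi : 'rV[R]_n -> \bar R) theta y : Ogroup theta ->
  legendre (psi \o rotate theta^T) y = legendre psi (y *m theta).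
Proof.
move=> tO; rewrite /legendre; congr ereal_sup; rewrite /rotate trmxK.
apply/seteqP; split => _ [z _ <-].
  by exists (z *m theta) => //=; rewrite dot_rotate.
exists (z *m theta^T) => //; rewrite /comp -[z *m _ *m _]mulmxA Ogroup_tr// mulmx1.
by rewrite dotC dot_mul trmxK dotC.
Qed.

Lemma closed_convex_rotate (psi : 'rV[R]_n -> \bar R) theta : Ogroup theta ->
  closed_convex psi -> closed_convex (psi \o rotate theta^T).
Proof.
move=> tO [Noo [x0 x0fin] cvx lscp]; rewrite /rotate trmxK; split => //=.
- by exists (x0 *m theta^T) => /=; rewrite -mulmxA Ogroup_tr// mulmx1.
- by move=> x y t t01 /=; rewrite mulmxDl -!scalemxAl; exact: cvx.
- move=> x a /= ax; have [V /nbhs_enorm[r r0 rV] Va] := lscp _ _ ax.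
  exists [set z | enorm (z - x) < r]; first exact: near_enorm.
  by move=> z /= zx; apply/Va/rV; rewrite -mulmxBl enorm_rotate.
Qed.

(** A supremum of functions that are continuous in the matrix. *)
Lemma legendre_orbit_lsc (psi : 'rV[R]_n -> \bar R) y :
  lower_semicontinuous (fun theta => legendre psi (y *m theta)).
Proof.
move=> theta c /legendre_gt[z zc].
have ct : continuous (fun t => dot (y *m t) z).
  apply: (continuous_big (op := +%R)) => [|j _]; first exact: add_continuous.
  have c1 : continuous (fun t : 'M[R]_n => (y *m t) ord0 j).
    have -> : (fun t => (y *m t) ord0 j) = (fun t => \sum_(k < n) y ord0 k * t k j) :> ('M[R]_n -> R).
      by apply/funext => t; rewrite mxE.
    apply: (continuous_big (op := +%R)) => [|k _]; first exact: add_continuous.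
    by move=> t; have a1 := @coord_continuous R n n k j t;
      have a2 := @cst_continuous 'M[R]_n R (y ord0 k) t; exact: (cvgM a2 a1).
  by move=> t; have a2 := @cst_continuous 'M[R]_n R (z ord0 j) t; exact: (cvgM (c1 t) a2).
case E : (psi z) zc => [b| |]// zc.
  exists [set t | b + c < dot (y *m t) z].
    by have := ct theta => /cvgr_gt; apply; move: zc; rewrite lte_fin; lra.
  by move=> t /= h; apply/legendre_gt; exists z; rewrite E lte_fin; lra.
exists setT; first exact: filterT.
by move=> t _; apply/legendre_gt; exists z; rewrite E ltNyr.
Qed.

End RotationGroup.

(** * The rotational mean of a Legendre transform *)

Lemma biconjugate_le {R : realType} {n : nat} (h : 'rV[R]_n -> \bar R) y c :
  (h y <= c%:E)%E -> (legendre (legendre h) y <= c%:E)%E.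
Proof.
move=> hc; apply/legendre_le => z; rewrite leNgt; apply/negP => H.
have : exists2 e, e < dot y z - c & (legendre h z <= e%:E)%E.
  move: H; case: (legendre h z) => [b| |]//; first by rewrite lte_fin => ?; exists b.
  by exists (dot y z - c - 1); [lra|rewrite leNye].
move=> [e ec /legendre_le/(_ y)] h1.
by have := le_trans h1 hc; rewrite lee_fin dotC; lra.
Qed.

Section RotationalMean.
Context {R : realType} {n : nat} (mu : probability (borelM R n) R).
Hypothesis muSO : mu SOgroup = 1%E.
Variable psi : 'rV[R]_n -> \bar R.
Hypothesis psi_closed : closed_convex psi.
Implicit Types (x y z : 'rV[R]_n) (theta : 'M[R]_n).

Let SO : set (borelM R n) := @SOgroup R n.
Let mSO : measurable SO := @measurable_SOgroup R n.

Definition orbit_legendre y : borelM R n -> \bar R :=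
  fun theta => legendre psi (y *m (theta : 'M[R]_n)).

Definition rot_mean y := (\int[mu]_(theta in SO) orbit_legendre y theta)%E.

Lemma rot_meanE y : rot_mean y =
  (\int[mu]_(theta in SOgroup) legendre psi (rotate (invmx (theta : 'M[R]_n)) y))%E.
Proof.
apply: eq_integral => theta /set_mem tSO.
by rewrite /orbit_legendre rotate_invmx.
Qed.

Lemma orbit_legendre_measurable y : measurable_fun SO (orbit_legendre y).
Proof.
by apply: measurable_funTS; apply: lsc_borelM_measurable; exact: legendre_orbit_lsc.
Qed.

(** A point [x0] where [psi] is finite yields
    [L psi (y theta) >= <y theta, x0> - psi x0], and [|y theta| = |y|]. *)
Lemma orbit_legendre_bounded : exists2 C, 0 <= C &
  forall y, bounded_below SO (C * (1 + enorm y)) (orbit_legendre y).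
Proof.
have [Noo [x0 x0fin] _ _] := psi_closed.
have [b b0] : exists b, psi x0 = b%:E.
  by move: x0fin (Noo x0); case: (psi x0) => // b _ _; exists b.
have e0 := enorm_ge0 x0; have b1 := normr_ge0 b.
exists (enorm x0 + `|b| + 1); first lra.
move=> y theta [tO _]; rewrite leNgt; apply/negP => /ltW/legendre_le/(_ x0).
rewrite b0 lee_fin.
have := dot_ge (y *m (theta : 'M[R]_n)) x0; rewrite enorm_rotate//.
have := enorm_ge0 y; have := ler_norm b => h1 h2 h3 h4.
have h5 : 0 <= `|b| * enorm y by rewrite mulr_ge0.
suff : (0 : R) < 0 by rewrite ltxx.
lra.
Qed.

Lemma bounded_belowW C C' (U : borelM R n -> \bar R) : C <= C' ->
  bounded_below SO C U -> bounded_below SO C' U.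
Proof. by move=> CC UC t tO; apply: le_trans (UC t tO); rewrite lee_fin lerN2. Qed.

Lemma rot_mean_minorant : exists2 C, 0 <= C & linear_minorant C rot_mean.
Proof.
have [C C0 UC] := orbit_legendre_bounded; exists C => // y.
apply: (integral_ge_bounded_below mSO muSO) => //.
- by rewrite mulr_ge0// addr_ge0 ?enorm_ge0.
- exact: orbit_legendre_measurable.
Qed.

Lemma rot_mean_le d M : growth d M psi ->
  forall y, dot y y <= d -> (rot_mean y <= M%:E)%E.
Proof.
move=> gr y yd; have [C C0 UC] := orbit_legendre_bounded.
rewrite -(integral_prob_cst mSO muSO M).
apply: (@integral_le_bounded_below _ _ _ mu SO mSO muSO (C * (1 + enorm y))) => //.
- by rewrite mulr_ge0// addr_ge0 ?enorm_ge0.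
- exact: orbit_legendre_measurable.
- by move=> theta [tO _]; apply: gr; rewrite dot_rotate.
Qed.

Lemma rot_mean_convex x y t a b : 0 < t < 1 ->
  (rot_mean x <= a%:E)%E -> (rot_mean y <= b%:E)%E ->
  (rot_mean (t *: x + (1 - t) *: y)%R <= (t * a + (1 - t) * b)%:E)%E.
Proof.
move=> t01; have [C C0 UC] := orbit_legendre_bounded.
have t0 : 0 < t by case/andP : t01.
have s0 : 0 < 1 - t by case/andP : t01; lra.
have ex := enorm_ge0 x; have ey := enorm_ge0 y.
apply: (@integral_convex_bounded_below _ _ _ mu SO mSO muSO (C * (1 + enorm x + enorm y))) => //.
- by rewrite mulr_ge0//; lra.
- exact: orbit_legendre_measurable.
- exact: orbit_legendre_measurable.
- exact: orbit_legendre_measurable.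
- by apply: bounded_belowW (UC x); rewrite ler_wpM2l//; lra.
- by apply: bounded_belowW (UC y); rewrite ler_wpM2l//; lra.
- apply: bounded_belowW (UC _); rewrite ler_wpM2l//.
  have := enormD (t *: x) ((1 - t) *: y); rewrite !enormZ !gtr0_norm//.
  have : t * enorm x <= enorm x by rewrite ler_piMl//; lra.
  have : (1 - t) * enorm y <= enorm y by rewrite ler_piMl//; lra.
  lra.
- move=> theta _; rewrite /orbit_legendre mulmxDl -!scalemxAl.
  apply: legendre_convex => //.
  by have [_ prop _ _] := psi_closed.
Qed.

(** Fatou's lemma along a sequence that would violate semicontinuity. *)
Lemma rot_mean_lsc : lower_semicontinuous rot_mean.
Proof.
move=> y a ay; apply: contrapT => N.
have [C C0 UC] := orbit_legendre_bounded.
have ey := enorm_ge0 y.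
have /choice[z_ zP] : forall k : nat, exists z : 'rV[R]_n,
    enorm (z - y) < k.+1%:R^-1 /\ (rot_mean z <= a%:E)%E.
  move=> k; apply: contrapT => Nk; apply: N.
  exists [set z | enorm (z - y) < k.+1%:R^-1]; first by apply: near_enorm; rewrite invr_gt0.
  by move=> z /= zy; rewrite ltNge; apply/negP => za; apply: Nk; exists z.
suff : (rot_mean y <= a%:E)%E by rewrite leNgt ay.
apply: (@fatou_bounded_below _ _ _ mu SO mSO muSO (C * (2 + enorm y)) _
  (fun k => orbit_legendre (z_ k))) => //.
- by rewrite mulr_ge0//; lra.
- exact: orbit_legendre_measurable.
- by move=> k; exact: orbit_legendre_measurable.
- by apply: bounded_belowW (UC y); rewrite ler_wpM2l//; lra.
- move=> k; apply: bounded_belowW (UC _); rewrite ler_wpM2l//.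
  have := enormD (z_ k - y) y; rewrite subrK.
  have [zk _] := zP k.
  have k1 : k.+1%:R^-1 <= 1 :> R by rewrite invf_le1// ler1n.
  have := lt_le_trans zk k1; lra.
- move=> theta c [tO _] cU.
  have [V /nbhs_enorm[r r0 rV] Vc] := legendre_lsc cU.
  near=> k; apply/Vc/rV; rewrite -mulmxBl enorm_rotate//.
  have [zk _] := zP k; apply: lt_trans zk _.
  near: k; exact: near_infty_natSinv_lt (PosNum r0).
- by move=> k; have [_] := zP k.
Unshelve. all: by end_near. Qed.

Lemma rot_mean_closed_convex d M : 0 <= d -> growth d M psi -> closed_convex rot_mean.
Proof.
move=> d0 gr; have [C C0 minor] := rot_mean_minorant.
have Noo y : (-oo < rot_mean y)%E by apply: lt_le_trans (minor y); exact: ltNyr.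
split => //.
- exists 0; apply: (@le_lt_trans _ _ M%:E); last exact: ltry.
  by apply: (rot_mean_le gr); rewrite dot0l.
- by apply: econvex_intro => // *; exact: rot_mean_convex.
- exact: rot_mean_lsc.
Qed.

(** [rot_mean] is closed and convex, hence the Legendre transform of its own
    Legendre transform, and the latter inherits the growth of [psi]. *)
Lemma rot_mean_predual d M : 0 < d -> growth d M psi ->
  exists phi, Convc phi /\ forall y, legendre phi y = rot_mean y.
Proof.
move=> d0 gr; have cl := rot_mean_closed_convex (ltW d0) gr.
have [C C0 minor] := rot_mean_minorant.
have [Noo prop cvx lsch] := cl.
have biconj y : legendre (legendre rot_mean) y = rot_mean y.
  apply/eqP; rewrite eq_le; apply/andP; split.
    have := @biconjugate_le _ _ rot_mean y; have := Noo y.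
    by case: (rot_mean y) => [b| |]// _; [apply|rewrite leey].
  apply: lee_from_below => c cy.
  have [x [e [xe ce]]] := fenchel_moreau C0 cl minor cy.
  rewrite ltW//; apply/legendre_gt; exists x; apply: le_lt_trans xe _.
  by rewrite lte_fin; lra.
exists (legendre rot_mean); split => //.
apply: (@growth_Convc _ _ d M) => //.
- split.
  + by move=> x; exact: legendre_gtNy.
  + have : ((- (C * (1 + enorm (0 : 'rV[R]_n))) - 1)%:E < rot_mean 0)%E.
      by apply: lt_le_trans (minor 0); rewrite lte_fin; lra.
    move=> /(fenchel_moreau C0 cl minor)[x [e [xe _]]].
    by exists x; apply: le_lt_trans xe _; exact: ltry.
  + exact: legendre_convex.
  + exact: legendre_lsc.
- by move=> y yd; rewrite biconj; exact: rot_mean_le gr _ yd.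
Qed.

Lemma epi_rotP : Convc psi -> Convc (epi_rot mu psi) /\
  forall y, legendre (epi_rot mu psi) y = rot_mean y.
Proof.
move=> cpsi; have [d [M [d0 gr]]] := Convc_growth cpsi.
have [phi [cphi phiE]] := rot_mean_predual d0 gr.
have := getPex (ex_intro (fun phi => Convc phi /\ forall y, legendre phi y =
      (\int[mu]_(theta in SOgroup) legendre psi (rotate (invmx (theta : 'M[R]_n)) y))%E) phi _).
case; first by split => // y; rewrite phiE rot_meanE.
by move=> c E; split => // y; rewrite rot_meanE -E.
Qed.

End RotationalMean.

(** * Approximating the rotational mean *)

(** Replaces an extended-real function by a real integrable one with almost the
    same mean: [U] itself, up to a null set, if its mean is finite, and a
    minorant with mean at least [K] otherwise. *)
Lemma integrable_approx {d} {T : measurableType d} {R : realType} (mu : probability T R)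
    (D : set T) (mD : measurable D) (muD : mu D = 1%E) (C K : R) (U : T -> \bar R) :
  0 <= C -> measurable_fun D U -> bounded_below D C U ->
  exists wm : (T -> R) * R,
    [/\ mu.-integrable D (EFin \o wm.1), (\int[mu]_(x in D) (wm.1 x)%:E = wm.2%:E)%E,
      {ae mu, forall x, D x -> ((wm.1 x)%:E <= U x)%E /\
        ((\int[mu]_(x in D) U x < +oo)%E -> U x = (wm.1 x)%:E)},
      (\int[mu]_(x in D) U x < +oo)%E -> (\int[mu]_(x in D) U x)%E = wm.2%:E &
      (\int[mu]_(x in D) U x)%E = +oo%E -> K <= wm.2].
Proof.
move=> C0 mU UC.
have [Uoo|] := ltP (\int[mu]_(x in D) U x)%E +oo%E; last first.
  rewrite leye_eq => /eqP Uoo.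
  have [w [iw wU Kw]] := integrable_minorant mD muD K C0 mU UC Uoo.
  have fw := integrable_fin_num mD iw.
  exists (w, fine (\int[mu]_(x in D) (w x)%:E)%E); split => //.
  - by rewrite fineK.
  - by apply: aeW => x Dx; split => //; exact: wU.
  - by move=> _; rewrite -lee_fin fineK.
have iU := integrable_bounded_below mD muD C0 mU UC Uoo.
have iw : mu.-integrable D (EFin \o (fun x => fine (U x))).
  apply: (le_integrable mD _ _ iU).
    apply/measurable_EFinP; apply: (measurableT_comp (@fine_measurable R setT measurableT)).
    exact: mU.
  by move=> x Dx /=; case: (U x) => [r| |]//=; rewrite ?normr0 ?leey.
have fU := integrable_fin_num mD iU.
have ae := integrable_ae mD iU.
have UE : (\int[mu]_(x in D) (fine (U x))%:E = \int[mu]_(x in D) U x)%E.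
  apply: ae_eq_integral => //; first by case/integrableP : iw.
  by apply: filterS ae => x fx Dx; rewrite fineK// fx.
exists (fun x => fine (U x), fine (\int[mu]_(x in D) U x)%E); split => //.
- by rewrite UE fineK.
- by apply: filterS ae => x fx Dx; rewrite fineK ?fx//; split.
- by rewrite fineK.
- by move=> Uy; rewrite Uy in Uoo.
Qed.

Section Approximation.
Context {R : realType} {n : nat} (mu : probability (borelM R n) R).
Hypothesis muSO : mu SOgroup = 1%E.
Variable psi : 'rV[R]_n -> \bar R.
Hypothesis psi_closed : closed_convex psi.
Variable S : set ('rV[R]_n -> \bar R).
Hypothesis S_closed : forall chi, S chi -> closed_convex chi.
Hypothesis S_winf : forall chi1 chi2 t, S chi1 -> S chi2 -> 0 < t < 1 -> S (winf t chi1 chi2).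
Hypothesis S_rot : forall theta, SOgroup theta -> S (psi \o rotate theta).
Implicit Types (x y z : 'rV[R]_n) (chi : 'rV[R]_n -> \bar R).

(** The vectors [v] such that some [chi] in [S] satisfies
    [v_j <= legendre chi (q j)] for [j <= k], with equality where the rotational
    mean is finite, form a convex set.  Through [integrable_approx] almost
    every rotation provides such a vector, so the mean vector is in the
    closure of this set. *)
Lemma mean_approx (q : nat -> 'rV[R]_n) (k : nat) (e K : R) : 0 < e ->
  exists2 chi, S chi & forall j, (j <= k)%N ->
    (forall a, (rot_mean mu psi (q j) <= a%:E)%E -> (legendre chi (q j) <= (a + e)%:E)%E) /\
    (forall c, c <= K -> (c%:E <= rot_mean mu psi (q j))%E -> ((c - e)%:E <= legendre chi (q j))%E).
Proof.
move=> e0.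
have [C C0 UC] := orbit_legendre_bounded psi_closed.
have mSO := @measurable_SOgroup R n.
have Cq j : 0 <= C * (1 + enorm (q j)) by rewrite mulr_ge0// addr_ge0 ?enorm_ge0.
have /choice[wm wmP] := fun j => integrable_approx mSO muSO K (Cq j)
  (orbit_legendre_measurable psi (q j)) (UC (q j)).
pose w j := (wm j).1; pose m j := (wm j).2.
(* where the mean is [+oo] an integrable minorant stands in for the orbit
   function *)
pose V := [set v : 'rV[R]_k.+1 | exists2 chi, S chi & forall j : 'I_k.+1,
  ((v ord0 j)%:E <= legendre chi (q j))%E /\
  ((rot_mean mu psi (q j) < +oo)%E -> (legendre chi (q j) <= (v ord0 j)%:E)%E)].
have H := @mean_in_closure _ _ _ mu SOgroup mSO muSO k.+1 V
  (fun theta => \row_j w j theta) (\row_j m j).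
have [v [chi Schi vchi] ve] : exists2 v, V v & enorm (v - \row_j m j) < e.
  apply: H => //.
  - move=> v v' t [chi Schi vchi] [chi' Schi' vchi'] t01.
    exists (winf t chi chi'); first exact: S_winf.
    have [Noo _ _ _] := S_closed Schi; have [Noo' _ _ _] := S_closed Schi'.
    move=> j; rewrite !mxE; have [l1 l2] := vchi j; have [l1' l2'] := vchi' j.
    split; first exact: winf_legendre_ge.
    by move=> hj; apply: winf_legendre_le => //; [exact: l2|exact: l2'].
  - move=> j; have [iw _ _ _ _] := wmP j.
    by apply: eq_integrable iw => // t _; rewrite /= mxE.
  - move=> j; have [_ wE _ _ _] := wmP j; rewrite mxE.
    by rewrite -wE; apply: eq_integral => t _; rewrite mxE.
  - have : \forall theta \ae mu, forall j, SOgroup theta ->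
      ((w j theta)%:E <= orbit_legendre psi (q j) theta)%E /\
      ((rot_mean mu psi (q j) < +oo)%E -> orbit_legendre psi (q j) theta = (w j theta)%:E).
      apply: ae_foralln => j; have [_ _ aew _ _] := wmP j.
      exact: aew.
    move=> [N [mN N0 sub]]; exists N; split => // theta nP.
    apply: sub => /= wP; apply: nP => tSO; exists (psi \o rotate theta^T).
      by apply: S_rot; exact: SOgroup_tr.
    have [tO _] := tSO.
    move=> j; rewrite legendre_rotate// mxE; have [h1 h2] := wP j tSO; split => //.
    by move=> /h2; rewrite /orbit_legendre => ->.
exists chi => // j jk.
have jk' : (j < k.+1)%N by [].
have [l1 l2] := vchi (Ordinal jk').
have vm : `|v ord0 (Ordinal jk') - m j| < e.
  apply: le_lt_trans ve; apply: le_trans (mx_norm_le_enorm _).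
  apply: le_trans (_ : `|(v - \row_j m j) ord0 (Ordinal jk')| <= _); first by rewrite !mxE.
  by rewrite [leRHS]/Num.norm /= mx_normrE; apply/bigmax_geP; right => /=; exists (ord0, Ordinal jk').
move: vm; rewrite ltr_norml => /andP[vm1 vm2].
have [_ _ _ mfin moo] := wmP j.
split => [a ha|c cK ch].
  have hoo : (rot_mean mu psi (q j) < +oo)%E by apply: le_lt_trans ha _; exact: ltry.
  apply: le_trans (l2 hoo) _; move: ha; rewrite /rot_mean (mfin hoo) !lee_fin -/(m j); lra.
apply: le_trans l1; rewrite lee_fin.
have [hoo|] := ltP (rot_mean mu psi (q j)) +oo%E.
  by move: ch; rewrite /rot_mean (mfin hoo) lee_fin -/(m j); lra.
by rewrite leye_eq => /eqP/moo; rewrite -/(m j); lra.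
Qed.
End Approximation.

(** * From dual convergence on a dense set to hypo-convergence *)

Section SmallLemmas.
Context {R : realType}.

Lemma exists_small (A m : R) : 0 <= A -> 0 < m -> exists t, 0 < t < 1 /\ t * A < m.
Proof.
move=> A0 m0; have d0 : 0 < m + A + 1 by lra.
exists (m / (m + A + 1)); split.
  by rewrite divr_gt0//= ltr_pdivrMr// mul1r; lra.
by rewrite mulrAC ltr_pdivrMr// ltr_pM2l//; lra.
Qed.

(** Turns each estimate on [exp (- psi)] into one on [psi]. *)
Lemma expNe_lt (v : \bar R) (e : R) : (-oo < v)%E -> 0 < e ->
  (expNe v < e) = ((- ln e)%:E < v)%E.
Proof.
move=> v0 e0; case: v v0 => [b| |]// _; rewrite /expNe /=.
  by rewrite lte_fin -ltr_ln ?posrE ?expR_gt0// expRK ltrNl.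
by rewrite e0 ltry.
Qed.

(** At step [k] take a point that serves the largest [N <= k] for which the
    tolerance [1 / (N + 1)] can be met. *)
Lemma diagonal_choice (T : Type) (t0 : T) (Q : nat -> T -> R -> Prop) :
  (forall k p e e', e <= e' -> Q k p e -> Q k p e') ->
  (forall e, 0 < e -> \forall k \near \oo, exists p, Q k p e) ->
  exists p_ : nat -> T, forall e, 0 < e -> \forall k \near \oo, Q k (p_ k) e.
Proof.
move=> Qmono Qe.
have H k m : exists p, forall N, (N <= m)%N ->
    (exists p', Q k p' N.+1%:R^-1) -> Q k p N.+1%:R^-1.
  elim: m => [|m [p IH]].
    have [[p Qp]|NQ] := pselect (exists p', Q k p' 1%:R^-1).
      by exists p => N; rewrite leqn0 => /eqP ->.
    by exists t0 => N; rewrite leqn0 => /eqP -> /NQ.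
  have [[p' Qp]|NQ] := pselect (exists p', Q k p' m.+2%:R^-1).
    exists p' => N Nm _; apply: Qmono Qp.
    by rewrite lef_pV2 ?posrE ?ltr0n// ler_nat.
  by exists p => N; rewrite leq_eqVlt => /predU1P[-> /NQ//|]; rewrite ltnS; exact: IH.
have /choice[p_ pP] := fun k => H k k.
exists p_ => e e0.
have [N Ne] : exists N : nat, N.+1%:R^-1 <= e.
  exists (Num.truncn e^-1); rewrite -[leRHS]invrK lef_pV2 ?posrE ?invr_gt0//.
  exact/ltW/truncnS_gt.
near=> k; apply: (Qmono _ _ _ _ Ne); apply: pP.
  by near: k; exists N.
by near: k; apply: Qe; rewrite invr_gt0.
Unshelve. all: by end_near. Qed.

(** [z] is a convex combination of [y], with weight [1 - t], and of a point of
    the ball where [g <= M]. *)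
Lemma convex_shrink n (g : 'rV[R]_n -> \bar R) d M y z c t : 0 <= d -> econvex g ->
  (forall b, dot b b <= d -> (g b <= M%:E)%E) -> (g y <= c%:E)%E -> 0 < t < 1 ->
  enorm (z - (1 - t) *: y) <= t * Num.sqrt d -> (g z <= ((1 - t) * c + t * M)%:E)%E.
Proof.
move=> d0 cvx gM gy /andP[t0 t1] zy.
have -> : z = (1 - t) *: y + (1 - (1 - t)) *: (t^-1 *: (z - (1 - t) *: y)).
  by rewrite subKr scalerA divff ?gt_eqF// scale1r addrC subrK.
have s01 : 0 < 1 - t < 1 by lra.
rewrite -[X in _ + X * M](subKr 1 t); apply: econvex_le => //; apply: gM.
rewrite -enorm_sqr -[leRHS]sqr_sqrtr// ler_pXn2r ?nnegrE ?enorm_ge0 ?sqrtr_ge0//.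
by rewrite enormZ gtr0_norm ?invr_gt0// mulrC ler_pdivrMr// mulrC.
Qed.

End SmallLemmas.

Section HypoConvergence.
Context {R : realType} {n : nat}.
Implicit Types (x y z p : 'rV[R]_n).
Variables (phi : 'rV[R]_n -> \bar R) (chi : nat -> 'rV[R]_n -> \bar R) (d M : R).
Variable q : nat -> 'rV[R]_n.
Hypothesis d0 : 0 < d.
Hypothesis phi_closed : closed_convex phi.
Hypothesis phi_growth : growth d M phi.
Hypothesis chi_closed : forall k, closed_convex (chi k).
Hypothesis chi_growth : forall k, growth d M (chi k).
Hypothesis q_dense : forall x r, 0 < r -> exists j, enorm (q j - x) < r.
Hypothesis dual_upper : forall j a, (legendre phi (q j) < a%:E)%E ->
  \forall k \near \oo, (legendre (chi k) (q j) <= a%:E)%E.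
Hypothesis dual_lower : forall j c, (c%:E < legendre phi (q j))%E ->
  \forall k \near \oo, (c%:E <= legendre (chi k) (q j))%E.

Let proper_convex (psi : 'rV[R]_n -> \bar R) : closed_convex psi -> econvex (legendre psi).
Proof. by move=> [_ prop _ _]; exact: legendre_convex. Qed.

Let sd0 : 0 < Num.sqrt d. Proof. by rewrite sqrtr_gt0. Qed.

(** Choose by duality a slope [y] that certifies [c < phi x], and move it to
    some [q j] close to [(1 - t) y]: by convexity this costs little in
    [legendre phi].  Young's inequality for [chi k] with the slope [q j]
    then bounds [chi k] from below near [x]. *)
Lemma epi_liminf x (x_ : nat -> 'rV[R]_n) c : x_ @ \oo --> x -> (c%:E < phi x)%E ->
  \forall k \near \oo, (c%:E < chi k (x_ k))%E.
Proof.
move=> x_x cx.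
have minor := growth_minorant (ltW d0) phi_growth.
have [y [e [ye ce]]] := fenchel_moreau (normr_ge0 M) phi_closed minor cx.
have ex := enorm_ge0 x.
have [t [t01 tA]] := @exists_small _ (`|dot x y - e| + enorm x * Num.sqrt d + `|M|) (dot x y - e - c)
  ltac:(by rewrite !addr_ge0// mulr_ge0// ltW) ltac:(lra).
have /andP[t0 t1] := t01.
(* the ball of radius [t * Num.sqrt d] around [(1 - t) y] is the range of
   [convex_shrink] *)
have [j qj] := q_dense ((1 - t) *: y) (mulr_gt0 t0 sd0).
have hq := convex_shrink (ltW d0) (proper_convex phi_closed) phi_growth ye t01 (ltW qj).
set a0 := (1 - t) * e + t * M in hq.
have gap : c < dot x (q j) - a0.
  have : dot x (q j) = (1 - t) * dot x y + dot x (q j - (1 - t) *: y) by rewrite !dotE; ring.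
  have := dot_ge x (q j - (1 - t) *: y).
  have : enorm x * enorm (q j - (1 - t) *: y) <= enorm x * (t * Num.sqrt d).
    by rewrite ler_wpM2l// ltW.
  have : t * M <= t * `|M| by rewrite ler_pM2l// ler_norm.
  have : t * (dot x y - e) <= t * `|dot x y - e| by rewrite ler_pM2l// ler_norm.
  rewrite /a0; lra.
set eta := (dot x (q j) - a0 - c) / 2.
have eta0 : 0 < eta by rewrite /eta; lra.
have : \forall k \near \oo, (legendre (chi k) (q j) <= (a0 + eta)%:E)%E.
  by apply: dual_upper; apply: le_lt_trans hq _; rewrite lte_fin; lra.
have near_x : \forall k \near \oo, enorm (x_ k - x) < eta / (enorm (q j) + 1).
  apply: (x_x [set z | enorm (z - x) < eta / (enorm (q j) + 1)]).
  apply: near_enorm; apply: divr_gt0 => //.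
  by have := enorm_ge0 (q j); lra.
apply: filterS2 near_x => k xk /legendre_le/(_ (x_ k)); apply: lt_le_trans.
rewrite lte_fin.
have eq0 := enorm_ge0 (q j).
move: xk; rewrite ltr_pdivlMr; last lra.
have := dot_ge (q j) (x_ k - x); have := enorm_ge0 (x_ k - x).
rewrite !dotE (dotC (q j) x) => h1 h2 h3.
have : eta = (dot x (q j) - a0 - c) / 2 by [].
nra.
Qed.

(** At a proximal point [p] of [chi k] at [x] with slope [y = 2K (x - p)], the
    left-hand side is [<x, y> - legendre (chi k) y].  The proximal points stay
    in a ball independent of [k].  Near each point [p0] of that ball, with
    slope [y0], a large value would make [legendre (chi k)] small at [y],
    hence, by convexity, at a point [q j] close to [y0], against [dual_lower]
    and [legendre phi y0 >= <x, y0> - phi x].  Compactness finishes. *)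
Lemma prox_upper x b0 K e : 0 < K -> 0 < e -> phi x = b0%:E ->
  \forall k \near \oo, exists p b, chi k p = b%:E /\ b + 2 * K * enorm (p - x) ^+ 2 <= b0 + e.
Proof.
move=> K0 e0 xb0; have sd := sd0.
have minor k := growth_minorant (ltW d0) (chi_growth k).
have prox k := prox_exists x K0 (normr_ge0 M) (chi_closed k) (minor k).
have h_ge y : ((dot x y - b0)%:E <= legendre phi y)%E.
  rewrite leNgt; apply/negP => H.
  have [c cb yc] : exists2 c, c < dot x y - b0 & (legendre phi y <= c%:E)%E.
    move: H; case: (legendre phi y) => [c| |]//; first by rewrite lte_fin => ?; exists c.
    by exists (dot x y - b0 - 1); [lra|rewrite leNye].
  by move: yc => /legendre_le/(_ x); rewrite xb0 lee_fin dotC; lra.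
have [rho bounded] : exists rho, \forall k \near \oo, forall p b,
    is_prox (chi k) K x p b -> enorm (p - x) <= rho.
  have [j qj] := @q_dense 0 (Num.sqrt d / 2) ltac:(lra).
  rewrite subr0 in qj.
  have [c cq] : exists c, (c%:E < legendre phi (q j))%E.
    exists (dot x (q j) - b0 - 1); apply: lt_le_trans (h_ge _); rewrite lte_fin; lra.
  (* [Z] bounds the near-maximizers of [<q j, .> - chi k], as [|q j|] is less
     than half of the growth rate *)
  set Z := (`|M| + `|c| + 1) / (Num.sqrt d / 2).
  have Z0 : 0 <= Z by rewrite /Z divr_ge0.
  set C1 := `|M| + Num.sqrt d / 2 * Z + `|c| + 1 + K * (Z + enorm x) ^+ 2.
  have C10 : 0 <= C1.
    have a1 : 0 <= Num.sqrt d / 2 * Z by rewrite mulr_ge0//; lra.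
    have a2 : 0 <= K * (Z + enorm x) ^+ 2 by rewrite mulr_ge0 ?sqr_ge0// ltW.
    by have := normr_ge0 M; have := normr_ge0 c; rewrite /C1; lra.
  exists (C1 / K + 1).
  apply: filterS (dual_lower cq) => k ck p b [pb pmin _].
  have [z zc] := legendre_ge_approx ltr01 ck.
  have g1 := le_trans (growth_ge z (ltW d0) (chi_growth k)) zc.
  have g2 := le_trans (pmin z) zc.
  have := growth_ge_cst p (ltW d0) (chi_growth k).
  move: g1 g2; rewrite pb !lee_fin.
  have n1 := ler_norm M; have n2 := ler_norm (- c); rewrite normrN in n2.
  have ez := enorm_ge0 z; have ep := enorm_ge0 (p - x).
  have dz : dot (q j) z <= Num.sqrt d / 2 * enorm z.
    by apply: le_trans (dot_le _ _) _; rewrite ler_wpM2r// ltW.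
  have exz : enorm (z - x) <= enorm z + enorm x by have := enormD z (- x); rewrite enormN.
  move=> g1 g2 g3.
  have zZ : enorm z <= Z by rewrite /Z ler_pdivlMr; lra.
  have h1 : K * enorm (z - x) ^+ 2 <= K * (Z + enorm x) ^+ 2.
    rewrite ler_pM2l// ler_pXn2r ?nnegrE ?enorm_ge0 ?addr_ge0 ?enorm_ge0//; lra.
  have h2 : Num.sqrt d / 2 * enorm z <= Num.sqrt d / 2 * Z by rewrite ler_wpM2l//; lra.
  have h3 : K * enorm (p - x) ^+ 2 <= C1 by rewrite /C1; lra.
  have h4 : enorm (p - x) ^+ 2 <= C1 / K by rewrite ler_pdivlMr// mulrC.
  rewrite leNgt; apply/negP => h5.
  have q0 : 0 <= C1 / K by rewrite divr_ge0// ltW.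
  nra.
pose P (k : nat) p := forall b, is_prox (chi k) K x p b -> b + 2 * K * enorm (p - x) ^+ 2 <= b0 + e.
have : \forall k \near \oo, [set p | enorm (p - x) <= rho] `<=` P k.
  have /compact_near_coveringP cK := @compact_enorm_ball R n x rho.
  apply: (cK nat \oo P) => p0 _.
  set y0 := (2 * K) *: (x - p0).
  set c0 := dot x y0 - b0 - e / 2.
  have c0h : (c0%:E < legendre phi y0)%E.
    by apply: lt_le_trans (h_ge y0); rewrite lte_fin /c0; lra.
  have [V /nbhs_enorm[r r0 rV] Vc] := legendre_lsc c0h.
  have ey := enorm_ge0 y0.
  pose m := Num.min (e / 4) r.
  have m0 : 0 < m by rewrite lt_min r0 andbT; lra.
  have mr : m <= r by rewrite ge_min lexx orbT.
  have me : m <= e / 4 by rewrite ge_min lexx.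
  (* [t] is small enough for [q j] to stay within [r] of [y0] and for the loss
     in [convex_shrink] to stay below [e / 4] *)
  have [t [t01 tA]] := @exists_small _ (`|M| + `|c0| + e + enorm y0 + Num.sqrt d) m
    ltac:(by rewrite !addr_ge0//; lra) m0.
  have /andP[t0 t1] := t01.
  have nM := ler_norm M; have nc := ler_norm (- c0); rewrite normrN in nc.
  have pM := normr_ge0 M; have pc := normr_ge0 c0.
  have ts0 : 0 < t * Num.sqrt d by rewrite mulr_gt0.
  have [j qj] := @q_dense ((1 - t) *: y0) (t * Num.sqrt d / 2) ltac:(lra).
  have qV : (c0%:E < legendre phi (q j))%E.
    apply/Vc/rV.
    have -> : q j - y0 = (q j - (1 - t) *: y0) + (- t) *: y0.
      by apply/rowP => i; rewrite !mxE; ring.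
    apply: le_lt_trans (enormD _ _) _; rewrite enormZ normrN gtr0_norm//.
    have : 0 <= t * (`|M| + `|c0| + e) by rewrite mulr_ge0//; lra.
    lra.
  have ex := enorm_ge0 x.
  (* [|p - p0| < s] keeps the slope within [t * Num.sqrt d / 2] of [y0], and
     changes [<x, y>] by at most [e / 4] *)
  set s := Num.min (t * Num.sqrt d / 2) (e / 4 / (enorm x + 1)) / (2 * K).
  have s0 : 0 < s.
    rewrite /s divr_gt0 ?lt_min//; last lra.
    by apply/andP; split; [lra|rewrite divr_gt0//; lra].
  exists ([set p | enorm (p - p0) < s], [set k | (c0%:E <= legendre (chi k) (q j))%E]).
    by split; [exact: near_enorm|exact: dual_lower].
  move=> [p k] [/= ps ck] b pr.
  rewrite leNgt; apply/negP => bad.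
  set y := (2 * K) *: (x - p).
  have yy0 : enorm (y - y0) < Num.min (t * Num.sqrt d / 2) (e / 4 / (enorm x + 1)).
    have -> : y - y0 = (- (2 * K)) *: (p - p0).
      by apply/rowP => i; rewrite !mxE; ring.
    rewrite enormZ normrN gtr0_norm; last lra.
    by move: ps; rewrite /s ltr_pdivlMr ?(mulrC (enorm _))//; lra.
  move: yy0; rewrite lt_min => /andP[yy1 yy2].
  have hy : (legendre (chi k) y <= (c0 - e / 4)%:E)%E.
    rewrite (prox_legendre pr) lee_fin -/y.
    have -> : dot y p - b = dot x y - (b + 2 * K * enorm (p - x) ^+ 2).
      by rewrite -(enormN (p - x)) opprB enorm_sqr /y !dotE (dotC x p); ring.
    have := dot_le x (y - y0); rewrite dotDr dotNr => h1.
    have h2 : enorm x * enorm (y - y0) <= e / 4.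
      move: yy2; rewrite ltr_pdivlMr; last lra.
      have := enorm_ge0 (y - y0); nra.
    rewrite /c0; lra.
  have := convex_shrink (ltW d0) (proper_convex (chi_closed k)) (@chi_growth k) hy t01 (z := q j).
  have -> : q j - (1 - t) *: y = (q j - (1 - t) *: y0) + (- (1 - t)) *: (y - y0).
    by apply/rowP => i; rewrite !mxE; ring.
  have near_q : enorm (q j - (1 - t) *: y0 + - (1 - t) *: (y - y0)) <= t * Num.sqrt d.
    apply: le_trans (enormD _ _) _; rewrite enormZ normrN gtr0_norm; last lra.
    have : (1 - t) * enorm (y - y0) <= enorm (y - y0) by rewrite ler_piMl ?enorm_ge0//; lra.
    lra.
  move=> /(_ near_q) H; have := le_trans ck H; rewrite lee_fin.
  have : t * M <= t * `|M| by rewrite ler_pM2l.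
  have : t * (- c0) <= t * `|c0| by rewrite ler_pM2l.
  have : 0 <= t * (enorm y0 + Num.sqrt d) by rewrite mulr_ge0//; lra.
  have : 0 <= t * e by rewrite mulr_ge0//; lra.
  have : t * (e / 4) <= t * e by rewrite ler_pM2l//; lra.
  lra.
apply: filterS2 bounded => k bk Pk.
have [p [b pr]] := prox k; exists p, b.
by split; [case: pr|apply: Pk => //; exact: bk pr].
Qed.

(** Since [chi k >= - M], letting [K] grow in [prox_upper] forces the proximal
    points to converge to [x]. *)
Lemma epi_recovery x b0 : phi x = b0%:E -> exists2 x_ : nat -> 'rV[R]_n, x_ @ \oo --> x &
  forall e, 0 < e -> \forall k \near \oo, (chi k (x_ k) <= (b0 + e)%:E)%E.
Proof.
move=> xb0.
pose Q (k : nat) p (e : R) := (chi k p <= (b0 + e)%:E)%E /\ enorm (p - x) <= e.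
have [x_ xP] : exists x_ : nat -> 'rV[R]_n, forall e, 0 < e -> \forall k \near \oo, Q k (x_ k) e.
  apply: (diagonal_choice x) => [k p e e' ee' [h1 h2]|e e0].
    by split; [apply: le_trans h1 _; rewrite lee_fin; lra|lra].
  (* for this [K], [b >= - M] and [b + 2K |p - x|^2 <= b0 + e] imply [|p - x|
     <= e] *)
  set K := (`|b0 + M| + e) / e ^+ 2.
  have n0 := normr_ge0 (b0 + M).
  have K0 : 0 < K by rewrite /K divr_gt0 ?exprn_gt0//; lra.
  apply: filterS (prox_upper K0 e0 xb0) => k [p [b [pb h]]].
  have p0 : 0 <= enorm (p - x) ^+ 2 by exact: sqr_ge0.
  exists p; split; first by rewrite pb lee_fin; have := mulr_ge0 (ltW K0) p0; lra.
  have := growth_ge_cst p (ltW d0) (@chi_growth k); rewrite pb lee_fin => bM.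
  have Ke : K * e ^+ 2 = `|b0 + M| + e by rewrite /K divfK// gt_eqF// exprn_gt0.
  rewrite -(@ler_pXn2r _ 2)// ?nnegrE ?enorm_ge0 ?(ltW e0)//.
  rewrite -(ler_pM2l K0) Ke.
  have := ler_norm (b0 + M); have := mulr_ge0 (ltW K0) p0; lra.
exists x_.
  apply/cvgrPdist_lt => e e0; have e2 : 0 < e / 2 by lra.
  apply: filterS (xP _ e2) => k [_ h].
  by rewrite distrC; apply: le_lt_trans (mx_norm_le_enorm _) _; lra.
by move=> e e0; apply: filterS (xP e e0) => k [].
Qed.

(** Convergence of the Legendre transforms on a dense set, with a common bound
    near 0, implies hypo-convergence: [epi_liminf] is the limsup condition,
    and with [epi_recovery] it gives the recovery sequence.  Where
    [phi x = +oo] a constant sequence recovers, by [epi_liminf] alone. *)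
Lemma hypo_cvg_of_dual : hypo_cvg (fun k => expN (chi k)) (expN phi).
Proof.
have [Noo _ _ _] := phi_closed.
have Nk k x : (-oo < chi k x)%E by have [] := chi_closed k.
have upper x (x_ : nat -> 'rV[R]_n) e : x_ @ \oo --> x -> 0 < e ->
    \forall k \near \oo, expN (chi k) (x_ k) < expN phi x + e.
  move=> x_x e0; have f0 : 0 <= expN phi x by exact: expNe_ge0.
  have fe : 0 < expN phi x + e by lra.
  have : ((- ln (expN phi x + e))%:E < phi x)%E.
    by rewrite -expNe_lt// /expN -/(expNe _); lra.
  move=> /(epi_liminf x_x); apply: filterS => k.
  by rewrite -expNe_lt.
move=> x; split => [x_ x_x|].
  apply/lee_addgt0Pr => e e0; apply: limn_esup_le.
  by apply: filterS (upper _ _ _ x_x e0) => k /ltW; rewrite -EFinD lee_fin.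
have := Noo x; case E : (phi x) => [b0| |]// _.
  have [x_ x_x xP] := epi_recovery E; exists x_; split => //.
  apply/cvgrPdist_lt => e e0.
  have fE : expN phi x = expR (- b0) by rewrite /expN E.
  have lower : \forall k \near \oo, expN phi x - e < expN (chi k) (x_ k).
    have [fe|fe] := leP (expN phi x - e / 2) 0.
      by apply: nearW => k; apply: lt_le_trans (expNe_ge0 _); lra.
    have : 0 < - ln (expN phi x - e / 2) - b0.
      rewrite subr_gt0 ltrNr -ltr_expR lnK ?posrE// -fE; lra.
    move=> /xP; apply: filterS => k; rewrite addrC subrK => h.
    rewrite ltNge; apply/negP => h2.
    have : expN (chi k) (x_ k) < expN phi x - e / 2 by lra.
    by rewrite [X in X < _]/(expNe _) expNe_lt// ltNge h.
  apply: filterS2 lower (upper _ _ _ x_x e0) => k h1 h2.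
  by rewrite ltr_norml; apply/andP; split; lra.
exists (fun=> x); split; first exact: cvg_cst.
apply/cvgrPdist_lt => e e0.
have cx : (fun=> x : 'rV[R]_n) @ \oo --> x by exact: cvg_cst.
apply: filterS (upper _ _ _ cx e0) => k h1.
have h2 : 0 <= expN (chi k) x by exact: expNe_ge0.
have h3 : expN phi x = 0 by rewrite /expN E.
by rewrite h3 in h1 *; rewrite sub0r normrN ger0_norm//; lra.
Qed.

End HypoConvergence.

(** * Rotational symmetrization *)

Section RationalPoints.
Context {R : realType} {n : nat}.

Definition rational_point (k : nat) : 'rV[R]_n :=
  if (unpickle k : option 'rV[rat]_n) is Some v then map_mx ratr v else 0.

Lemma rational_point_dense (x : 'rV[R]_n) (r : R) : 0 < r ->
  exists k, enorm (rational_point k - x) < r.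
Proof.
move=> r0; have /nbhs_ballP[e /= e0 eV] := near_enorm x r0.
have /choice[v vP] : forall i, exists v : rat, `|x ord0 i - ratr v| < e.
  move=> i; have /rat_in_itvoo[v] : x ord0 i - e < x ord0 i + e by lra.
  rewrite in_itv /= => /andP[v1 v2]; exists v.
  by rewrite ltr_norml; apply/andP; split; lra.
exists (pickle (\row_i v i)); rewrite /rational_point pickleK.
apply: eV; rewrite /ball /=; split => // i j.
by rewrite ord1 !mxE; exact: vP.
Qed.

End RationalPoints.

Section RotationalSymmetrization.
Context {R : realType} {n : nat} (mu : probability (borelM R n) R).
Variable G : ('rV[R]_n -> R) -> \bar R.
Hypotheses (muSO : mu SOgroup = 1%E) (G_nonneg : nonneg_functional G)
  (G_lsc : hypo_lsc G) (G_conv : log_convex G) (G_inv : invariant_under SOgroup G).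

(** [S] is the family of functions with the growth of [psi] at which [G] does
    not exceed [G (expN psi)]; [mean_approx] gives a sequence in it that
    hypo-converges to the symmetrization. *)
Lemma epi_rot_le (psi : 'rV[R]_n -> \bar R) : Convc psi ->
  (G (expN (epi_rot mu psi)) <= G (expN psi))%E.
Proof.
move=> cpsi; have psi_closed := Convc_closed_convex cpsi.
have [d [M [d0 gr]]] := Convc_growth cpsi.
have [cphi phiE] := epi_rotP muSO psi_closed cpsi.
set phi := epi_rot mu psi in cphi phiE *.
pose S := [set chi : 'rV[R]_n -> \bar R | [/\ closed_convex chi, growth d M chi &
  (G (expN chi) <= G (expN psi))%E]].
have S_winf chi1 chi2 t : S chi1 -> S chi2 -> 0 < t < 1 -> S (winf t chi1 chi2).
  move=> [c1 g1 G1] [c2 g2 G2] t01.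
  have [N1 _ _ _] := c1; have [N2 _ _ _] := c2.
  split; first exact: winf_closed_convex d0 g1 g2 c1 c2.
    exact: winf_growth.
  exact: log_convex_winf t01 d0 _ _ c1 g1 c2 g2 G1 G2.
have S_rot theta : SOgroup theta -> S (psi \o rotate theta).
  move=> tSO; have [tO _] := SOgroup_tr tSO.
  rewrite -(trmxK theta); split; first exact: closed_convex_rotate.
    by move=> y yd; rewrite legendre_rotate//; apply: gr; rewrite dot_rotate.
  have -> : expN (psi \o rotate theta^T^T) = expN psi \o rotate theta by rewrite trmxK.
  by rewrite G_inv//; exists psi.
have S_closed chi : S chi -> closed_convex chi by case.
have /choice[chi chiP] : forall k : nat, exists chi, S chi /\ forall j, (j <= k)%N ->
    (forall a, (rot_mean mu psi (rational_point j) <= a%:E)%E ->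
      (legendre chi (rational_point j) <= (a + k.+1%:R^-1)%:E)%E) /\
    (forall c, c <= k%:R -> (c%:E <= rot_mean mu psi (rational_point j))%E ->
      ((c - k.+1%:R^-1)%:E <= legendre chi (rational_point j))%E).
  move=> k; have ke : 0 < k.+1%:R^-1 :> R by rewrite invr_gt0.
  have [chi Schi H] := mean_approx muSO psi_closed S_closed S_winf S_rot rational_point k k%:R ke.
  by exists chi.
have gphi : growth d M phi by move=> y yd; rewrite phiE; exact: (rot_mean_le muSO psi_closed gr yd).
have chi_closed k : closed_convex (chi k) by have [[]] := chiP k.
have chi_growth k : growth d M (chi k) by have [[]] := chiP k.
have hypo : hypo_cvg (fun k => expN (chi k)) (expN phi).
  apply: (hypo_cvg_of_dual d0 (Convc_closed_convex cphi) gphi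
    chi_closed chi_growth rational_point_dense).
  - move=> j a; rewrite phiE => ja.
    have [b ba jb] : exists2 b, b < a & (rot_mean mu psi (rational_point j) <= b%:E)%E.
      move: ja; case: (rot_mean _ _ _) => [b| |]//; first by rewrite lte_fin => ?; exists b.
      by exists (a - 1); [lra|rewrite leNye].
    have ab : 0 < a - b by lra.
    near=> k; have [_ H] := chiP k.
    have jk : (j <= k)%N by near: k; exact: nbhs_infty_ge.
    have [H1 _] := H j jk.
    apply: le_trans (H1 b jb) _; rewrite lee_fin -lerBrDl ltW//.
    near: k; exact: near_infty_natSinv_lt (PosNum ab).
  - move=> j c; rewrite phiE => jc.
    have [b cb jb] : exists2 b, c < b & (b%:E <= rot_mean mu psi (rational_point j))%E.
      move: jc; case: (rot_mean _ _ _) => [b| |]//; first by rewrite lte_fin => ?; exists b.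
      by exists (c + 1); [lra|rewrite leey].
    have bc : 0 < b - c by lra.
    near=> k; have [_ H] := chiP k.
    have jk : (j <= k)%N by near: k; exact: nbhs_infty_ge.
    have [_ H1] := H j jk.
    have kb : b <= k%:R by near: k; exact: nbhs_infty_ger.
    apply: le_trans (H1 b kb jb); rewrite lee_fin lerBrDr -lerBrDl ltW//.
    near: k; exact: near_infty_natSinv_lt (PosNum bc).
have Lchi k : LCc (expN (chi k)) by exists (chi k) => //; exact: growth_Convc (chi_growth k).
have Lphi : LCc (expN phi) by exists phi.
apply: le_trans (G_lsc Lchi Lphi hypo) _; apply: limn_einf_le => k.
by have [[_ _]] := chiP k.
Unshelve. all: by end_near. Qed.

End RotationalSymmetrization.

Theorem theorem8p4 (R : realType) :
  (forall (n : nat) (mu : probability (borelM R n) R)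
          (G : ('rV[R]_n -> R) -> \bar R),
     (2 <= n)%N ->
     haar_SO mu ->
     nonneg_functional G ->
     hypo_lsc G ->
     log_convex G ->
     invariant_under SOgroup G ->
     forall (f : 'rV[R]_n -> R) (psi : 'rV[R]_n -> \bar R),
       Convc psi -> f = expN psi ->
       (G (expN (epi_rot mu psi)) <= G f)%E)
  /\
  (forall G : ('rV[R]_1 -> R) -> \bar R,
     nonneg_functional G ->
     log_convex G ->
     invariant_under Ogroup G ->
     forall (f : 'rV[R]_1 -> R) (psi : 'rV[R]_1 -> \bar R),
       Convc psi -> f = expN psi ->
       (G (expN (epi_rot1 psi)) <= G f)%E).
Proof.
split=> [n mu G _ [muSO _] G0 Glsc Gconv Ginv f psi cpsi ->|G G0 Gconv Ginv f psi cpsi ->].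
  exact: epi_rot_le.
exact: epi_rot1_le.
Qed.
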